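(* Let $\sigma$ be an implicit signature. If the pseudovariety of groups $\mathsf{H}$ is graph $\sigma$-reducible, then the pseudovariety $\mathsf{V}=\mathsf{DO}\cap\overline{\mathsf{H}}$ is $(\sigma\cup\{\_^\omega\})$-reducible for the idempotent pointlike problem.
   Context: $\mathsf{S}$ is the pseudovariety of all finite semigroups, and for a finite set $A$, $\overline{\Omega}_A\mathsf{S}$ is the free profinite semigroup on $A$; its elements are called pseudowords. For a pseudovariety $\mathsf{V}$ of semigroups, $\overline{\Omega}_A\mathsf{V}$ is the free pro-$\mathsf{V}$ semigroup on $A$ and $p_{\mathsf{V}}:\overline{\Omega}_A\mathsf{S}\to\overline{\Omega}_A\mathsf{V}$ is the canonical projection. $\mathsf{DO}$ is the pseudovariety of all finite semigroups in which every regular $\mathcal{J}$-class is a subsemigroup isomorphic to a direct product of a rectangular band and a group. For a pseudovariety $\mathsf{H}$ of groups, $\overline{\mathsf{H}}$ is the pseudovariety of all finite semigroups all of whose subgroups lie in $\mathsf{H}$. So $\mathsf{DO}\cap\overline{\mathsf{H}}$ consists of all finite semigroups in which every regular $\mathcal{J}$-class is the product of a rectangular band by a group from $\mathsf{H}$. An implicit signature is a set $\sigma$ of pseudowords (elements of finitely generated free profinite semigroups, viewed as implicit operations) that contains binary multiplication. Pseudowords have a natural interpretation as operations on every profinite semigroup, so every profinite semigroup is a $\sigma$-algebra; $\Omega^\sigma_A\mathsf{S}$ is the $\sigma$-subalgebra of $\overline{\Omega}_A\mathsf{S}$ generated by $A$. The operation $\_^\omega$ is the unary operation which in a finite semigroup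 maps $x$ to its unique idempotent power $x^\omega$. A nonempty subset $P$ of a finite semigroup $S$ is $\mathsf{V}$-idempotent pointlike if for every finite set $A$ and every onto continuous homomorphism $\varphi:\overline{\Omega}_A\mathsf{S}\to S$ there is a subset $P'\subseteq\overline{\Omega}_A\mathsf{S}$ such that $\varphi(P')=P$ and $p_{\mathsf{V}}(P')$ is a singleton consisting of an idempotent. $\mathsf{V}$ is $\sigma$-reducible for the idempotent pointlike problem if, for every finite semigroup $S$, every $\mathsf{V}$-idempotent pointlike subset $P$ of $S$ and every such $\varphi$, the set $P'$ can be chosen to be a subset of $\Omega^\sigma_A\mathsf{S}$. Graph reducibility: to a finite directed graph $\Gamma$ (viewed as the disjoint union of its vertices and edges, all regarded as variables) associate the system consisting of the equation $xy=z$ for each edge $y$ from vertex $x$ to vertex $z$. Constraints in a finite semigroup $S$ are given by a function $\psi:\Gamma\to S$. Given a continuous onto homomorphism $\varphi:\overline{\Omega}_A\mathsf{S}\to S$, a $\mathsf{V}$-solution of the constrained system is a function $\gamma:\Gamma\to\overline{\Omega}_A\mathsf{S}$ such that $\varphi(\gamma(x))=\psi(x)$ for every $x\in\Gamma$ (vertex or edge) and $p_{\mathsf{V}}(\gamma(x)\gamma(y))=p_{\mathsf{V}}(\gamma(z))$ for every edge $y$ from $x$ to $z$. $\mathsf{V}$ is graph $\sigma$-reducible if every constrained system associated with a finite directed graph $\Gamma$ that admits a $\mathsf{V}$-solution also admits a $\mathsf{V}$-solution $\gamma$ with $\gamma(\Gamma)\subseteq\Omega^\sigma_A\mathsf{S}$.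 *)

(* Defs.v *)
Set Warnings "-notation-overridden,-redundant-canonical-projection,-notation-incompatible-prefix".
From HB Require Import structures.
From mathcomp Require Import all_boot.
From mathcomp Require Import boolp classical_sets functions topology.

Set Implicit Arguments.
Unset Strict Implicit.
Unset Printing Implicit Defensive.

Local Open Scope classical_set_scope.
Local Open Scope group_scope.

HB.mixin Record isNonempty T of Finite T := { nonempty_card : (0 < #|{: T}|)%N }.

#[short(type="finSemigroupType")]
HB.structure Definition FinSemigroup :=
  { T of Semigroup T & Finite T & isNonempty T }.

Section ProdFinSemigroup.
Variables S T : finSemigroupType.

Fact prod_card_gt0 : (0 < #|{: S * T}|)%N.
Proof. by rewrite card_prod muln_gt0 !nonempty_card. Qed.

HB.instance Definition _ := isNonempty.Build (S * T)%type prod_card_gt0.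
End ProdFinSemigroup.

(* A subsemigroup is an injective homomorphism and a homomorphic image is a
   surjective one, so each of these two closure conditions includes closure
   under isomorphism. *)
Record pseudovariety (V : finSemigroupType -> Prop) : Prop := {
  pv_inhabited : exists S, V S;
  pv_sub : forall (S T : finSemigroupType) (f : {multiplicative S -> T}),
    injective f -> V T -> V S;
  pv_image : forall (S T : finSemigroupType) (f : {multiplicative S -> T}),
    range f = setT -> V S -> V T;
  pv_prod : forall S T : finSemigroupType, V S -> V T -> V (S * T)%type
}.

Definition is_group (S : finSemigroupType) : Prop :=
  exists e : S, (forall x, e * x = x /\ x * e = x) /\
                (forall x, exists y, x * y = e /\ y * x = e).

Record group_pseudovariety (H : finSemigroupType -> Prop) : Prop := {
  gpv_pseudovariety : pseudovariety H;
  gpv_group : forall S, H S -> is_group S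
}.

Definition rectangular_band (S : finSemigroupType) : Prop :=
  forall x y : S, x * x = x /\ x * y * x = x.

Section Green.
Variable S : semigroupType.

(* [option S] is S^1: [None] is the adjoined identity. *)
Definition mul1l (u : option S) (x : S) : S := if u is Some s then s * x else x.
Definition mul1r (x : S) (v : option S) : S := if v is Some s then x * s else x.

Definition J_le (x y : S) : Prop :=
  exists u v : option S, x = mul1r (mul1l u y) v.

Definition J_class (x : S) : set S := [set y | J_le x y /\ J_le y x].

Definition regular (x : S) : Prop := exists y, x * y * x = x.
End Green.

Definition DO (S : finSemigroupType) : Prop :=
  forall x : S, regular x ->
  exists (B G : finSemigroupType) (f : {multiplicative (B * G)%type -> S}),
    [/\ rectangular_band B, is_group G, injective f & range f = J_class x].

Definition bar (H : finSemigroupType -> Prop) (S : finSemigroupType) : Prop :=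
  forall (G : finSemigroupType) (f : {multiplicative G -> S}),
    is_group G -> injective f -> H G.

Definition DO_bar (H : finSemigroupType -> Prop) (S : finSemigroupType) : Prop :=
  DO S /\ bar H S.

(* Every finite semigroup is isomorphic to one carried by some 'I_n.+1; these
   representatives form a small type over which the projective limit below can
   be taken. *)
Record mulTable := MulTable {
  table_pred : nat;
  table_mul : 'I_table_pred.+1 -> 'I_table_pred.+1 -> 'I_table_pred.+1;
  table_mulA : associative table_mul
}.

Definition table_sort (t : mulTable) : Type := 'I_(table_pred t).+1.
Coercion table_sort : mulTable >-> Sortclass.

HB.instance Definition _ (t : mulTable) := Finite.on (table_sort t).

Fact table_mulgA (t : mulTable) :
  @associative (table_sort t) (@table_mul t).
Proof. exact: table_mulA. Qed.

HB.instance Definition _ (t : mulTable) :=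
  isSemigroup.Build (table_sort t) (@table_mulgA t).

Fact table_card_gt0 (t : mulTable) : (0 < #|{: table_sort t}|)%N.
Proof. by rewrite card_ord. Qed.

HB.instance Definition _ (t : mulTable) :=
  isNonempty.Build (table_sort t) (table_card_gt0 t).

Record marked (V : finSemigroupType -> Prop) (A : finType) := Marked {
  base : mulTable;
  base_in : V base;
  mark : A -> base
}.

HB.instance Definition _ V A := gen_eqMixin (marked V A).
HB.instance Definition _ V A := gen_choiceMixin (marked V A).

(* [Omega V A] is the projective limit of all A-marked members of V along the
   homomorphisms that respect the markings, with the topology induced by the
   product of the discrete topologies. Equivalently, its elements are the A-ary
   implicit operations on V. *)
Definition marked_prod (V : finSemigroupType -> Prop) (A : finType) :
    topologicalType :=
  prod_topology (fun i : marked V A => discrete_topology (base i)).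

Definition natural_family V A (x : marked_prod V A) : Prop :=
  forall (i j : marked V A) (h : {multiplicative base i -> base j}),
    (forall a, h (mark i a) = mark j a) -> h (x i) = x j.

Definition Omega (V : finSemigroupType -> Prop) (A : finType) : Type :=
  set_type [set x : marked_prod V A | natural_family x].

HB.instance Definition _ V A := Topological.copy (Omega V A)
  (set_type [set x : marked_prod V A | natural_family x]).

Definition coord V A (x : Omega V A) (i : marked V A) : base i := set_val x i.

Lemma coordP V A (x : Omega V A) : natural_family (coord x).
Proof. exact: set_mem (valP x). Qed.

Definition mkOmega V A (x : forall i : marked V A, base i)
  (nx : @natural_family V A x) : Omega V A :=
  exist (fun y => y \in [set z | natural_family z]) (x : marked_prod V A)
    (mem_set nx).

Lemma Omega_eqP V A (x y : Omega V A) :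
  (forall i, coord x i = coord y i) -> x = y.
Proof. by move=> xy; apply: val_inj; apply: functional_extensionality_dep. Qed.

Section OmegaSemigroup.
Variables (V : finSemigroupType -> Prop) (A : finType).

Fact Omega_mul_natural (x y : Omega V A) :
  @natural_family V A (fun i => coord x i * coord y i).
Proof. by move=> i j h hm; rewrite gmulfM !(coordP _ hm). Qed.

Definition Omega_mul (x y : Omega V A) := mkOmega (Omega_mul_natural x y).

Fact Omega_mulA : associative Omega_mul.
Proof. by move=> x y z; apply: Omega_eqP => i; apply: mulgA. Qed.

HB.instance Definition _ := isSemigroup.Build (Omega V A) Omega_mulA.

Fact Omega_gen_natural (a : A) : @natural_family V A (fun i => mark i a).
Proof. by move=> i j h hm; apply: hm. Qed.

Definition Omega_gen (a : A) : Omega V A := mkOmega (Omega_gen_natural a).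
End OmegaSemigroup.

Definition allS (S : finSemigroupType) : Prop := True.

Notation pseudoword := (Omega allS).

Section Projection.
Variables (V : finSemigroupType -> Prop) (A : finType).

Definition forgetV (i : marked V A) : marked allS A := Marked I (@mark V A i).

Fact proj_natural (x : pseudoword A) :
  @natural_family V A (fun i => coord x (forgetV i)).
Proof. by move=> i j h hm; apply: (coordP x (i := forgetV i) (j := forgetV j)). Qed.

Definition Omega_proj (x : pseudoword A) : Omega V A :=
  mkOmega (proj_natural x).
End Projection.

Arguments Omega_proj V {A} x.

Section Interpretation.
Variables (n : nat) (A : finType).

Definition mark_subst (u : 'I_n -> pseudoword A) (i : marked allS A) :
  marked allS 'I_n := @Marked allS 'I_n (base i) I (fun k => coord (u k) i).

Fact interp_natural (w : pseudoword 'I_n) (u : 'I_n -> pseudoword A) :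
  @natural_family allS A (fun i => coord w (mark_subst u i)).
Proof.
move=> i j h hm; apply: (coordP w (i := mark_subst u i) (j := mark_subst u j)).
by move=> k /=; apply: coordP.
Qed.

(* The operation of arity n on the free profinite semigroup on A that the
   pseudoword w defines; in each finite semigroup it evaluates w. *)
Definition interp (w : pseudoword 'I_n) (u : 'I_n -> pseudoword A) :
  pseudoword A := mkOmega (interp_natural w u).
End Interpretation.

Definition opset := forall n : nat, set (pseudoword 'I_n).

Definition binary_mul : pseudoword 'I_2 :=
  Omega_gen allS (ord0 : 'I_2) * Omega_gen allS (ord_max : 'I_2).

Definition implicit_signature (sigma : opset) : Prop := sigma 2 binary_mul.

(* [spow x k] is x to the power k + 1. *)
Definition spow (S : semigroupType) (x : S) (k : nat) : S := iter k (mul x) x.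

Definition idempotent_power (S : semigroupType) (x e : S) : Prop :=
  e * e = e /\ exists k, e = spow x k.

(* A singleton, by [omega_wordE]. *)
Definition omega_word : set (pseudoword 'I_1) :=
  [set w | forall i, idempotent_power (mark i ord0) (coord w i)].

Definition add_omega (sigma : opset) : opset := fun n =>
  sigma n `|` match n return set (pseudoword 'I_n) with
              | 1 => omega_word
              | _ => set0
              end.

Inductive sigma_word (sigma : opset) (A : finType) : pseudoword A -> Prop :=
| sigma_word_gen a : sigma_word sigma (Omega_gen allS a)
| sigma_word_op n (w : pseudoword 'I_n) (u : 'I_n -> pseudoword A) :
    sigma n w -> (forall k, sigma_word sigma (u k)) ->
    sigma_word sigma (interp w u).

Lemma spowD (S : semigroupType) (x : S) j k :
  spow x j * spow x k = spow x (j + k).+1.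
Proof. by elim: j => //= j IH; rewrite -mulgA IH. Qed.

Lemma idempotent_power_uniq (S : semigroupType) (x e f : S) :
  idempotent_power x e -> idempotent_power x f -> e = f.
Proof.
have spow_idem (k m : nat) :
    spow x k * spow x k = spow x k -> spow x (k.+1 * m + k) = spow x k.
  move=> kk; elim: m => [|m IH]; first by rewrite muln0.
  have -> : (k.+1 * m.+1 + k = (k + (k.+1 * m + k)).+1)%N.
    by rewrite mulnS -addnA addSn.
  by rewrite -spowD IH.
move=> [ee [j ej]] [ff [k fk]]; subst e f.
rewrite -(spow_idem j k ee) -(spow_idem k j ff); congr (spow x _).
by rewrite !mulSn (mulnC k j) addnC -addnA; congr addn; apply: addnC.
Qed.

Lemma idempotent_power_ex (S : finSemigroupType) (x : S) :
  exists e, idempotent_power x e.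
Proof.
have /injectivePn [a [b ab fab]] :
    ~~ injectiveb (fun k : 'I_#|S|.+1 => spow x k).
  by apply/negP => /injectiveP /leq_card; rewrite card_ord ltnn.
wlog {ab} ab : a b fab / (a < b)%N.
  move=> WL; move: ab; rewrite neq_ltn => /orP[] ab; first exact: WL ab.
  exact: WL (esym fab) ab.
set p := (b - a.+1)%N.
have bE : nat_of_ord b = (a + p).+1 by rewrite /p -addSn subnKC.
have per m : (a <= m)%N -> spow x (m + p.+1) = spow x m.
  elim: m => [|m IH].
    by rewrite leqn0 => /eqP a0; move: fab; rewrite bE a0.
  rewrite leq_eqVlt => /orP[/eqP <-|/IH]; first by rewrite addnS -bE.
  exact: (congr1 (mul x)).
have pers m l : (a <= m)%N -> spow x (m + l * p.+1) = spow x m.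
  move=> am; elim: l => [|l IH]; first by rewrite addn0.
  by rewrite mulSn addnCA addnC per ?IH // (leq_trans am) // leq_addr.
exists (spow x (a.+1 * p.+1).-1); split; last by exists (a.+1 * p.+1).-1.
rewrite spowD.
have -> : (((a.+1 * p.+1).-1 + (a.+1 * p.+1).-1).+1
           = (a.+1 * p.+1).-1 + a.+1 * p.+1)%N.
  by rewrite -addnS prednK.
by rewrite pers // -ltnS prednK // leq_pmulr.
Qed.

Lemma omega_wordE : exists w, omega_word = [set w].
Proof.
have natx : @natural_family allS 'I_1
    (fun i => sval (cid (idempotent_power_ex (mark i ord0)))).
  move=> i j h hm; case: cid => e [ee [k ek]] /=; case: cid => f /= fP.
  apply: idempotent_power_uniq fP; split; first by rewrite -gmulfM ee.
  exists k; rewrite {}ek -hm; elim: k => //= k <-.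
  by rewrite gmulfM.
have omegaP : omega_word (mkOmega natx) by move=> i; apply: svalP.
exists (mkOmega natx); apply/seteqP; split=> [w ww|w ->] //=.
by apply: Omega_eqP => i; apply: idempotent_power_uniq (ww i) (omegaP i).
Qed.

Definition onto_continuous (A : finType) (S : finSemigroupType)
    (phi : {multiplicative pseudoword A -> S}) : Prop :=
  continuous (phi : pseudoword A -> discrete_topology S) /\ range phi = setT.

Definition idem_pointlike_witness (V : finSemigroupType -> Prop) (A : finType)
    (S : finSemigroupType) (phi : {multiplicative pseudoword A -> S})
    (P : set S) (P' : set (pseudoword A)) : Prop :=
  phi @` P' = P /\
  exists e : Omega V A, e * e = e /\ Omega_proj V @` P' = [set e].

Definition idem_pointlike (V : finSemigroupType -> Prop)
    (S : finSemigroupType) (P : set S) : Prop :=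
  P !=set0 /\
  forall (A : finType) (phi : {multiplicative pseudoword A -> S}),
    onto_continuous phi -> exists P', idem_pointlike_witness V phi P P'.

Definition idem_pointlike_reducible (sigma : opset)
    (V : finSemigroupType -> Prop) : Prop :=
  forall (S : finSemigroupType) (P : set S), idem_pointlike V P ->
  forall (A : finType) (phi : {multiplicative pseudoword A -> S}),
    onto_continuous phi ->
    exists P', idem_pointlike_witness V phi P P' /\
               P' `<=` [set w | sigma_word sigma w].

Record finDigraph := FinDigraph {
  vertex : finType;
  edge : finType;
  source : edge -> vertex;
  target : edge -> vertex
}.

Definition digraph_var (Gamma : finDigraph) : Type :=
  (vertex Gamma + edge Gamma)%type.

Definition graph_solution (V : finSemigroupType -> Prop) (Gamma : finDigraph)
    (A : finType) (S : finSemigroupType)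
    (phi : {multiplicative pseudoword A -> S}) (psi : digraph_var Gamma -> S)
    (gamma : digraph_var Gamma -> pseudoword A) : Prop :=
  (forall x, phi (gamma x) = psi x) /\
  (forall y : edge Gamma,
     Omega_proj V (gamma (inl (source y)) * gamma (inr y)) =
     Omega_proj V (gamma (inl (target y)))).

Definition graph_reducible (sigma : opset) (V : finSemigroupType -> Prop) :
    Prop :=
  forall (Gamma : finDigraph) (S : finSemigroupType)
    (psi : digraph_var Gamma -> S)
    (A : finType) (phi : {multiplicative pseudoword A -> S}),
    onto_continuous phi ->
    (exists gamma, graph_solution V phi psi gamma) ->
    exists gamma, graph_solution V phi psi gamma /\
                  forall x, sigma_word sigma (gamma x).

(* Main.v *)
Require Import Defs.
Set Warnings "-notation-overridden,-redundant-canonical-projection,-notation-incompatible-prefix".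
From HB Require Import structures.
From mathcomp Require Import all_boot.
From Stdlib Require List.
From mathcomp Require Import boolp classical_sets functions topology.

Set Implicit Arguments.
Unset Strict Implicit.
Unset Printing Implicit Defensive.

Local Open Scope classical_set_scope.
Local Open Scope group_scope.

(* A family of pseudowords that agree over V = DO /\ bar H is treated by induction
   on its content B. Splitting off the prefix that ends with the last letter of B to
   appear is compatible with equality over V: the values of both factors of the
   splitting at the first occurrence of a letter can be computed in a semigroup that
   is again in V. Iterating, either the content of the remainder drops, or a
   repetition among the values in the finite semigroup S lets one insert an omega
   power of content B without changing these values. In the second case, and dually
   from the right, the family becomes p e^omega u f^omega q with p, e, f, q of a
   shape already dealt with. As the semigroups of V are in DO, the value of the
   sandwich e^omega u f^omega over V depends only on the value of u over H. So the
   family is a fixed term in families u that only need to agree over H. Over H the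
   omega powers vanish, so idempotency of the family says that a product of letters
   and of such u's, each occurring once, is 1: this is the system of a directed
   cycle, and parallel edges express that the members of a family agree over H.
   Letters and contents are imposed by enlarging S. *)

Definition mkMul (S T : semigroupType) (f : S -> T) (fM : {morph f : x y / x * y}) :
    {multiplicative S -> T} :=
  HB.pack_for {multiplicative S -> T} f (isMultiplicative.Build S T f fM).

(** * Auxiliary finite semigroups *)

Section TableOf.
Variable T : finSemigroupType.

Fact card_predK : #|T| = #|T|.-1.+1.
Proof. by rewrite prednK // nonempty_card. Qed.

Definition to_ord (x : T) : 'I_#|T|.-1.+1 := cast_ord card_predK (enum_rank x).
Definition of_ord (i : 'I_#|T|.-1.+1) : T := enum_val (cast_ord (esym card_predK) i).

Lemma to_ordK : cancel to_ord of_ord.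
Proof. by move=> x; rewrite /of_ord /to_ord cast_ordK enum_rankK. Qed.

Lemma of_ordK : cancel of_ord to_ord.
Proof. by move=> x; rewrite /of_ord /to_ord enum_valK cast_ordKV. Qed.

Definition ord_mul i j := to_ord (of_ord i * of_ord j).

Fact ord_mulA : associative ord_mul.
Proof. by move=> i j k; rewrite /ord_mul !to_ordK mulgA. Qed.

(** Coordinates of [Omega] exist only at semigroups carried by some ['I_n.+1]; this copy makes every
    finite semigroup available for evaluation. *)
Definition table_of : mulTable := MulTable ord_mulA.

Fact to_tab_mul : {morph (to_ord : T -> table_of) : x y / x * y}.
Proof. by move=> x y; rewrite {2}/mul /= /ord_mul !to_ordK. Qed.

Fact of_tab_mul : {morph (of_ord : table_of -> T) : x y / x * y}.
Proof. by move=> x y; rewrite {1}/mul /= /ord_mul !to_ordK. Qed.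

Definition to_tab : {multiplicative T -> table_of} := mkMul to_tab_mul.
Definition of_tab : {multiplicative table_of -> T} := mkMul of_tab_mul.
End TableOf.

Section SubSemigroup.
Variables (T : finSemigroupType) (Q : T -> Prop).
Hypothesis Q_mul : forall x y, Q x -> Q y -> Q (x * y).
Hypothesis Q_ex : exists x, Q x.

Definition subsg : Type := {x : T | `[< Q x >]}.
HB.instance Definition _ := Finite.on subsg.

Fact subsg_mulP (x y : subsg) : `[< Q (sval x * sval y) >].
Proof.
case: x y => [x Qx] [y Qy]; apply/asboolP.
exact: Q_mul (asboolW Qx) (asboolW Qy).
Qed.

Definition subsg_mul (x y : subsg) : subsg := exist _ (sval x * sval y) (subsg_mulP x y).

Fact subsg_mulA : associative subsg_mul.
Proof. by move=> x y z; apply: (@val_inj _ _ {x : T | `[< Q x >]}); apply: mulgA. Qed.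

HB.instance Definition _ := isSemigroup.Build subsg subsg_mulA.

Fact subsg_card : (0 < #|{: subsg}|)%N.
Proof. by case: Q_ex => x /asboolP Qx; apply/card_gt0P; exists (exist _ x Qx : subsg). Qed.

HB.instance Definition _ := isNonempty.Build subsg subsg_card.

Definition sub_semigroup : finSemigroupType := subsg.

Definition sub_incl : {multiplicative sub_semigroup -> T} :=
  @mkMul sub_semigroup T (fun x : subsg => sval x) (fun x y => erefl).

End SubSemigroup.

Section Adjoin1.
Variable S : semigroupType.

Definition adj1 : Type := option S.
HB.instance Definition _ := Choice.on adj1.

Definition adj1_mul (x y : adj1) : adj1 :=
  if x is Some s then if y is Some t then Some (s * t) else x else y.

Fact adj1_mulA : associative adj1_mul.
Proof. by move=> [x|] [y|] [z|] //=; rewrite mulgA. Qed.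

HB.instance Definition _ := isSemigroup.Build adj1 adj1_mulA.

Lemma mulx1 (x : adj1) : x * (None : adj1) = x.
Proof. by case: x. Qed.

Lemma SomeM (x y : S) : (Some (x * y) : adj1) = (Some x : adj1) * (Some y : adj1).
Proof. by []. Qed.
End Adjoin1.

Arguments adj1 S : clear implicits.

HB.instance Definition _ (S : finSemigroupType) := Finite.copy (adj1 S) (option S).

Fact adj1_card (S : finSemigroupType) : (0 < #|{: adj1 S}|)%N.
Proof. by apply/card_gt0P; exists None. Qed.

HB.instance Definition _ (S : finSemigroupType) := isNonempty.Build (adj1 S) (adj1_card S).

Definition adj1_map (S T : semigroupType) (f : S -> T) : adj1 S -> adj1 T := omap f.

Lemma adj1_mapM (S T : semigroupType) (f : S -> T) :
  {morph f : x y / x * y} -> {morph adj1_map f : x y / x * y}.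
Proof. by move=> fM [x|] [y|] //; rewrite /mul /= fM. Qed.

Definition lzero_sg (n : nat) : Type := 'I_n.+1.
HB.instance Definition _ n := Finite.on (lzero_sg n).
Definition lzero_sg_mul n (x y : lzero_sg n) := x.
Fact lzero_sg_mulA n : associative (@lzero_sg_mul n). Proof. by []. Qed.
HB.instance Definition _ n := isSemigroup.Build (lzero_sg n) (@lzero_sg_mulA n).
Fact lzero_sg_card n : (0 < #|{: lzero_sg n}|)%N. Proof. by rewrite card_ord. Qed.
HB.instance Definition _ n := isNonempty.Build (lzero_sg n) (lzero_sg_card n).

(** In a null semigroup no [Some a] is a product, so this value identifies a single letter. *)
Definition null_sg (X : choiceType) : Type := option X.
HB.instance Definition _ (X : choiceType) := Choice.on (null_sg X).
HB.instance Definition _ (X : finType) := Finite.copy (null_sg X) (option X).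
Definition null_mul X (x y : null_sg X) : null_sg X := None.
Fact null_mulA X : associative (@null_mul X). Proof. by []. Qed.
HB.instance Definition _ X := isSemigroup.Build (null_sg X) (@null_mulA X).
Fact null_card (X : finType) : (0 < #|{: null_sg X}|)%N.
Proof. by apply/card_gt0P; exists None. Qed.
HB.instance Definition _ (X : finType) := isNonempty.Build (null_sg X) (null_card X).

Definition cset (A : finType) : Type := {set A}.
HB.instance Definition _ (A : finType) := Finite.on (cset A).
Fact cset_mulA (A : finType) : associative (@finset.setU A).
Proof. exact: finset.setUA. Qed.
HB.instance Definition _ (A : finType) := isSemigroup.Build (cset A) (@cset_mulA A).
Fact cset_card (A : finType) : (0 < #|{: cset A}|)%N.
Proof. by apply/card_gt0P; exists finset.set0. Qed.
HB.instance Definition _ (A : finType) := isNonempty.Build (cset A) (cset_card A).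

(** * Values of pseudowords in finite semigroups *)

Section Eval.
Variable A : finType.
Implicit Types (T : finSemigroupType) (u v : pseudoword A).

Definition tmark T (m : A -> T) : marked allS A :=
  @Marked allS A (table_of T) I (fun a => to_tab T (m a)).

Definition ev T (m : A -> T) u : T := of_tab T (coord u (tmark m)).

Lemma evM T (m : A -> T) : {morph ev m : u v / u * v}.
Proof. by move=> u v; rewrite /ev -gmulfM. Qed.

Lemma ev_gen T (m : A -> T) a : ev m (Omega_gen allS a) = m a.
Proof. exact: to_ordK. Qed.

Lemma ev_nat T T' (m : A -> T) (m' : A -> T') (h : {multiplicative T -> T'}) u :
  (forall a, h (m a) = m' a) -> h (ev m u) = ev m' u.
Proof.
move=> hm; have gM : {morph (fun x => to_tab T' (h (of_tab T x))) : x y / x * y}.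
  by move=> x y; rewrite !gmulfM.
rewrite /ev -(@coordP _ _ u (tmark m) (tmark m') (mkMul gM)) /= ?to_ordK //.
by move=> a; rewrite to_ordK hm.
Qed.

Lemma coord_ev u (i : marked allS A) : coord u i = ev (mark i) u.
Proof.
rewrite /ev.
symmetry; apply: (@coordP _ _ u (tmark (mark i)) i (of_tab (base i))) => a.
exact: to_ordK.
Qed.

Lemma pseudoword_eqP u v : (forall T (m : A -> T), ev m u = ev m v) -> u = v.
Proof. by move=> uv; apply: Omega_eqP => i; rewrite !coord_ev. Qed.

(** On an empty alphabet the two-element left zero semigroup has only one marking, yet naturality
    along the two constant maps from the trivial semigroup would give [u] two values there. *)
Lemma alphabet_inhabited u : exists a : A, True.
Proof.
apply: contrapT => nA; pose m (a : A) : lzero_sg 0 := ord0.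
have hM (x : lzero_sg 1) : {morph (fun=> x) : s t / (s : lzero_sg 0) * t >-> s * t} by [].
have e x := @ev_nat _ _ m (fun=> x) (mkMul (hM x)) u (fun=> erefl).
have /(congr1 val) : (ord0 : lzero_sg 1) = ord_max.
  apply: etrans (e ord0) (etrans _ (esym (e ord_max))).
  congr ev; apply: functional_extensionality_dep => a.
  by case: nA; exists a.
by [].
Qed.

(* Density of the free semigroup in the free profinite semigroup, phrased as an
   induction principle. *)
Lemma ev_ind T (m : A -> T) (Q : T -> Prop) u :
  (forall a, Q (m a)) -> (forall x y, Q x -> Q y -> Q (x * y)) -> Q (ev m u).
Proof.
move=> Qm QM; have [a0 _] := alphabet_inhabited u.
have Qex : exists x, Q x by exists (m a0).
have Qa a : `[< Q (m a) >] by apply/asboolP.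
pose n a : sub_semigroup QM Qex := exist _ (m a) (Qa a).
rewrite -(@ev_nat _ _ n m (sub_incl QM Qex)) //=.
by apply/asboolP; case: (ev n u).
Qed.

Lemma ev_pair T T' (m : A -> T) (m' : A -> T') u :
  ev (fun a => (m a, m' a)) u = (ev m u, ev m' u).
Proof.
rewrite [LHS]surjective_pairing; congr pair.
  exact: (@ev_nat _ _ _ m (@fst T T' : {multiplicative _ -> _})).
exact: (@ev_nat _ _ _ m' (@snd T T' : {multiplicative _ -> _})).
Qed.

Definition content u : {set A} := ev (fun a => [set a]%SET : cset A) u.

Lemma contentM u v : content (u * v) = content u :|: content v.
Proof. by rewrite /content evM. Qed.

Lemma content_gen a : content (Omega_gen allS a) = [set a]%SET.
Proof. by rewrite /content ev_gen. Qed.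

(** This is [ev_ind] in the product with the semilattice of subsets, so that a value and the content
    are followed together. *)
Lemma ev_content_ind T (m : A -> T) (Q : T -> {set A} -> Prop) u :
  (forall a, Q (m a) [set a]%SET) ->
  (forall x y C D, Q x C -> Q y D -> Q (x * y) (C :|: D)) -> Q (ev m u) (content u).
Proof.
move=> Qm QM; pose n a := (m a, [set a]%SET : cset A).
have := @ev_ind _ n (fun z => Q z.1 z.2) u; rewrite ev_pair; apply=> //.
by move=> x y; apply: QM.
Qed.

End Eval.

(** * Green's relations and stability in finite semigroups *)

Section GreenRelations.
Variable S : semigroupType.
Implicit Types x y z : S.

Lemma J_leP x y :
  J_le x y <-> exists u v : adj1 S, (Some x : adj1 S) = u * (Some y : adj1 S) * v.
Proof.
split=> [[u [v ->]]|[u [v]]]; first by exists u, v; case: u v => [?|] [?|].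
by case: u v => [u|] [v|] [->]; [exists (Some u), (Some v) | exists (Some u), None
  | exists None, (Some v) | exists None, None].
Qed.

Lemma J_le_refl x : J_le x x.
Proof. by exists None, None. Qed.

Lemma J_le_trans y x z : J_le x y -> J_le y z -> J_le x z.
Proof.
move=> /J_leP[u [v xy]] /J_leP[u' [v' yz]]; apply/J_leP; exists (u * u'), (v' * v).
by rewrite xy yz !mulgA.
Qed.

Lemma J_leMl x y : J_le (x * y) y.
Proof. by exists (Some x), None. Qed.

Lemma J_leMr x y : J_le (x * y) x.
Proof. by exists None, (Some y). Qed.

Lemma J_le_mid x y z : J_le (x * y * z) y.
Proof. by exists (Some x), (Some z). Qed.

Definition J_eq x y := J_le x y /\ J_le y x.

Lemma J_eq_sym x y : J_eq x y -> J_eq y x.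
Proof. by case. Qed.

Lemma J_eq_trans y x z : J_eq x y -> J_eq y z -> J_eq x z.
Proof. by move=> [? ?] [? ?]; split; apply: (@J_le_trans y). Qed.
End GreenRelations.

Lemma J_le_morph (S T : semigroupType) (f : S -> T) x y :
  {morph f : x y / x * y} -> J_le x y -> J_le (f x) (f y).
Proof.
move=> fM [u [v ->]]; exists (omap f u), (omap f v).
by case: u v => [u|] [v|]; rewrite /= ?fM.
Qed.

Lemma spow_comm (S : semigroupType) (x : S) k : x * spow x k = spow x k * x.
Proof. by elim: k => //= k IH; rewrite {1}IH mulgA. Qed.

Section Reassociation.
Variable S : semigroupType.
Implicit Types a b c d r : S.

(* The second components apply inside a longer right-associated product. *)
Lemma asc2 a b r : a * b = r -> (a * b = r) * (forall x, a * (b * x) = r * x).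
Proof. by move=> <-; split=> // x; rewrite mulgA. Qed.

Lemma asc3 a b c r : a * b * c = r ->
  (a * (b * c) = r) * (forall x, a * (b * (c * x)) = r * x).
Proof. by move=> <-; split=> [|x]; rewrite !mulgA. Qed.

End Reassociation.

Section Stability.
Variable S : finSemigroupType.
Implicit Types a c e : S.

Lemma stable_pow a c e k : e = a * e * c -> e = spow a k * e * spow c k.
Proof.
move=> ee; elim: k => [//|k IH].
rewrite -[spow a k.+1]/(a * spow a k) -[spow c k.+1]/(c * spow c k) spow_comm.
by rewrite {1}IH {1}ee !mulgA.
Qed.

(** Since [e = a^k * e * c^k] for all positive [k], [e] absorbs on the right the idempotent power of
    [c], which can be written [c * w]. *)
Lemma stable_r a c e : e = a * e * c -> exists w, e * (c * w) = e.
Proof.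
move=> ee; have [f [ff [k fk]]] := idempotent_power_ex c.
have ef : e * f = e by rewrite (stable_pow k ee) -fk -!mulgA ff.
case: k fk => [|k] fk; last by exists (spow c k); rewrite -[c * _]fk.
by exists c; rewrite -[c]fk ff.
Qed.

Lemma stable_l a c e : e = a * e * c -> exists w, (w * a) * e = e.
Proof.
move=> ee; have [f [ff [k fk]]] := idempotent_power_ex a.
have ef : f * e = e by rewrite (stable_pow k ee) -fk !mulgA ff.
case: k fk => [|k] fk; first by exists a; rewrite -[a]fk ff.
by exists (spow a k); rewrite -spow_comm -[a * _]fk.
Qed.
End Stability.

(** With the idempotent [e = x * y], write [z = u * e * v] and [e = p * z * q] in S^1. Stability
    provides [w] and [w'] for which [q * w * w' * p] is a weak inverse of [z]. *)
Lemma regular_J (S : finSemigroupType) (x z : S) : regular x -> J_eq z x -> regular z.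
Proof.
move=> [y yx] zx; have ee : x * y * (x * y) = x * y by rewrite mulgA yx.
set e := x * y in ee.
have ze : J_eq z e.
  apply: J_eq_trans zx _; split; last exact: J_leMr.
  by rewrite -{1}yx; apply: J_leMr.
clearbody e; move: ze => [] /J_leP[u [v zE]] /J_leP[p [q eE]].
have eE' : (Some e : adj1 S) = (p * u) * (Some e : adj1 S) * (v * q).
  by rewrite {1}eE zE !mulgA.
have [w we] := stable_r eE'; have [w' w'e] := stable_l eE'.
have : (Some z : adj1 S) * ((q * w) * (w' * p)) * Some z = Some z.
  have -> : (Some z : adj1 S) * ((q * w) * (w' * p)) * Some z
    = u * ((Some e : adj1 S) * ((v * q) * w)) * ((w' * (p * u)) * (Some e : adj1 S)) * v.
    by rewrite zE !mulgA.
  have See : (Some e : adj1 S) * (Some e : adj1 S) = Some e by rewrite -SomeM ee.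
  by rewrite we w'e zE -!mulgA (asc2 See).
(* If the weak inverse is the adjoined identity, [z] is idempotent and serves as its own. *)
case: (_ * (w' * p)) => [y'|] [zz]; first by exists y'.
by exists z; rewrite zz.
Qed.

(** * Characterization of DO by idempotents *)

(** For finite semigroups this is equivalent to [DO], by [DO_idem_J_rect] and [idem_J_rect_DO], and
    it is easier to check on constructed semigroups. *)
Definition idem_J_rect (S : semigroupType) :=
  forall e f : S, e * e = e -> f * f = f -> J_eq e f -> e * f * e = e.

Lemma group_idem (S : finSemigroupType) (e x : S) :
  (forall x, e * x = x /\ x * e = x) -> (forall x, exists y, x * y = e /\ y * x = e) ->
  x * x = x -> x = e.
Proof.
move=> e1 einv xx; have [y [xy _]] := einv x.
by rewrite -[x](e1 x).2 -xy mulgA xx.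
Qed.

(** The idempotents of B x G are the pairs (b, 1), and B is rectangular. *)
Lemma DO_idem_J_rect (S : finSemigroupType) : DO S -> idem_J_rect S.
Proof.
move=> DS e f ee ff [ef fe].
have [B [G [h [rB [i [i1 iV]] h_inj hJ]]]] : _ :=
  DS e (ex_intro _ e (etrans (congr1 (mul^~ e) ee) ee)).
have idG (b : B) g : h (b, g) * h (b, g) = h (b, g) -> g = i.
  by rewrite -gmulfM => /h_inj[_]; apply: group_idem.
have : J_class e e by split; apply: J_le_refl.
rewrite -hJ => -[[b g] _ eE]; have : J_class e f by split.
rewrite -hJ => -[[c k] _ fE]; rewrite -eE -fE in ee ff *.
rewrite -!gmulfM; congr (h (_, _)); first exact: (rB _ _).2.
by rewrite (idG _ _ ee) (idG _ _ ff) /= !(i1 _).1.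
Qed.

Section DOCriterion.
Variable S : finSemigroupType.
Hypothesis rectS : idem_J_rect S.

(** The idempotents [e = z * z1] and [f = z1 * z] are J-equivalent. From [e * f * e = e] and
    [f * e * f = f] one gets [z = s * z * z = z * z * t], so [z] lies in a subgroup with identity
    [b = s * z = z * t]. *)
Lemma regular_completely (z : S) : regular z -> exists b z',
  [/\ b * b = b, b * z = z, z * b = z & J_eq b z] /\
  [/\ z * z' = b, z' * z = b, b * z' = z' & z' * b = z'].
Proof.
move=> [z1 zz]; set e := z * z1; set f := z1 * z.
have ee : e * e = e by rewrite /e mulgA zz.
have ff : f * f = f by rewrite /f -mulgA [z * _]mulgA zz.
have Jef : J_eq e f.
  split; last by rewrite /f -{1}zz mulgA; apply: J_le_mid.
  by rewrite /e -{1}zz -[z * z1 * z]mulgA; apply: J_le_mid.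
have efe := rectS ee ff Jef; have fef := rectS ff ee (J_eq_sym Jef).
set s := z * z1 * z1; set t := z1 * z1 * z.
have zs : s * z * z = z.
  by have := congr1 (mul^~ z) efe; rewrite /s /e /f -!mulgA !(asc3 zz).
have zt : z * z * t = z.
  by have := congr1 (mul z) fef; rewrite /t /e /f -!mulgA !(asc3 zz).
clearbody s t; have sz : s * z = z * t by rewrite -{1}zt !mulgA zs.
have [b bE] : exists b, s * z = b by exists (s * z).
have bz : b * z = z by rewrite -bE.
have zb : z * b = z by rewrite -bE sz mulgA.
have bb : b * b = b by rewrite -{1}bE -mulgA zb.
have Jbz : J_eq b z by split; [rewrite -bE; apply: J_leMl | rewrite -{1}bz; apply: J_leMr].
exists b, (b * t * b); split; first by split.
have bt : b * t = b * s * b.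
  by rewrite -{3}bE sz !mulgA -[b * s * z]mulgA bE bb.
have z'E : b * t * b = b * s * b by rewrite bt -mulgA bb.
split; last by rewrite -mulgA bb.
- by rewrite !mulgA zb -sz bE bb.
- by rewrite z'E -mulgA bz -mulgA bE bb.
- by rewrite !mulgA bb.
Qed.

Section Build.
Variable e : S.
Hypothesis ee : e * e = e.

(** The two factors of the J-class of [e]: its idempotents form the rectangular band, and the group
    of units of eSe is the group. *)
Definition Jband (b : S) := b * b = b /\ J_eq b e.
Definition Hgroup (g : S) := exists g',
  (e * g = g /\ g * e = g) /\ [/\ g * g' = e, g' * g = e, e * g' = g' & g' * e = g'].

Lemma Jband_rect b c : Jband b -> Jband c -> b * c * b = b.
Proof.
by move=> [bb be] [cc ce]; apply: rectS => //; apply: J_eq_trans be (J_eq_sym ce).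
Qed.

Lemma Jband_mul b c : Jband b -> Jband c -> Jband (b * c).
Proof.
move=> Bb Bc; have bcb := Jband_rect Bb Bc; split; first by rewrite mulgA bcb.
apply: J_eq_trans Bb.2; split; first exact: J_leMr.
by rewrite -{1}bcb; apply: J_leMr.
Qed.

Lemma Jband_rect3 b c d : Jband b -> Jband c -> Jband d -> b * c * d = b * d.
Proof.
move=> Bb Bc Bd; rewrite -{1}(Jband_rect Bd Bb) !mulgA.
by rewrite -[b * c * d]mulgA (Jband_rect Bb) //; apply: Jband_mul.
Qed.

Lemma Jband_e : Jband e.
Proof. by split=> //; split; apply: J_le_refl. Qed.

Lemma Hgroup_e : Hgroup e.
Proof. by exists e. Qed.

Lemma Hgroup_mul g h : Hgroup g -> Hgroup h -> Hgroup (g * h).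
Proof.
move=> [g' [[eg ge] [gg' g'g eg' g'e]]] [h' [[eh he] [hh' h'h eh' h'e]]].
exists (h' * g'); split; first by split=> //; rewrite ?mulgA ?eg // -mulgA he.
split; last by rewrite -mulgA g'e.
- by rewrite -mulgA [h * _]mulgA hh' eg'.
- by rewrite -mulgA [g' * _]mulgA g'g eh.
- by rewrite mulgA eh'.
Qed.

Definition Jb := sub_semigroup Jband_mul (ex_intro _ e Jband_e).
Definition Hg := sub_semigroup Hgroup_mul (ex_intro _ e Hgroup_e).

Lemma JbP (b : Jb) : Jband (sval b).
Proof. by case: b => b Qb; apply: asboolW Qb. Qed.

Lemma HgP (g : Hg) : Hgroup (sval g).
Proof. by case: g => g Qg; apply: asboolW Qg. Qed.

Lemma Jb_rectangular : rectangular_band Jb.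
Proof.
move=> x y; split; apply: (@val_inj _ _ {x : S | `[< Jband x >]}) => /=.
  exact: (JbP x).1.
exact: Jband_rect (JbP x) (JbP y).
Qed.

Lemma Hg_group : is_group Hg.
Proof.
pose He : Hg := exist _ e (asboolT Hgroup_e).
exists He; split=> [x|x].
  have [x' [[ex xe] _]] := HgP x.
  by split; apply: (@val_inj _ _ {x : S | `[< Hgroup x >]}).
have [x' [[ex xe] [xx' x'x ex' x'e]]] := HgP x.
have Qx' : Hgroup x' by exists (sval x).
exists (exist _ x' (asboolT Qx') : Hg).
by split; apply: (@val_inj _ _ {x : S | `[< Hgroup x >]}).
Qed.

(** The map (b, g) to b g b carries the group at [e] to the group at the idempotent b. *)
Definition Jprod (p : (Jb * Hg)%type) : S := sval p.1 * sval p.2 * sval p.1.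

(** A product of band elements depends only on its first and last factors. Inserting [e] next to the
    group elements therefore reduces both sides to [b * g * h * c]. *)
Lemma JprodM : {morph Jprod : x y / x * y}.
Proof.
move=> [b g] [c h]; rewrite /Jprod /=.
change (sval (b * c)) with (sval b * sval c); change (sval (g * h)) with (sval g * sval h).
have := HgP g; have := HgP h; have := JbP b; have := JbP c; have Be := Jband_e.
move: (sval b) (sval c) (sval g) (sval h) => {}b {}c {}g {}h Bc Bb.
move=> [h' [[eh he] _]] [g' [[eg ge] _]].
have -> : b * c * (g * h) * (b * c) = b * c * e * g * h * (e * b * c).
  by rewrite !mulgA -[_ * e * g]mulgA eg -[_ * h * e]mulgA he.
rewrite (Jband_rect3 Bb Bc Be) (Jband_rect3 Be Bb Bc).
have -> : b * g * b * (c * h * c) = b * g * (e * b * c * e) * h * c.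
  by rewrite -{1}ge -{1}eh !mulgA.
rewrite (Jband_rect3 Be Bb Bc) (Jband_rect Be Bc) !mulgA.
by rewrite -[b * e * g]mulgA eg -[_ * g * e]mulgA ge -[_ * h * e]mulgA he.
Qed.

(** The group part is recovered as [e * (b * g * b) * e]. Then [b = (b * g' * b) * (c * g * c)]
    gives [b * c = b], and [c = (b * g * b) * (c * g' * c)] gives [b * c = c]. *)
Lemma Jprod_inj : injective Jprod.
Proof.
move=> [b g] [c h]; rewrite /Jprod /= => bh.
suff [-> ->] : b = c /\ g = h by [].
have [vb vg] : (sval b = sval c) /\ (sval g = sval h); last first.
  by split; apply: (@val_inj _ _ {x : S | _}).
have := HgP g; have := HgP h; have := JbP b; have := JbP c; have Be := Jband_e.
move: (sval b) (sval c) (sval g) (sval h) bh => {}b {}c {}g {}h bh Bc Bb.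
move=> [h' [[eh he] _]] [g' [[eg ge] [gg' g'g eg' g'e]]].
have gh : g = h.
  have eJe d k : Jband d -> e * k = k -> k * e = k -> e * (d * k * d) * e = k.
    move=> Bd ek ke; have -> : e * (d * k * d) * e = e * d * e * k * (e * d * e).
      by rewrite !mulgA -[_ * e * k]mulgA ek -[_ * k * e]mulgA ke.
    by rewrite (Jband_rect Be Bd) ek ke.
  by rewrite -(eJe _ _ Bb eg ge) bh (eJe _ _ Bc eh he).
split=> //; subst h.
have ebe d : Jband d -> g * d * g' = e /\ g' * d * g = e.
  move=> Bd; have H u v : u * e = u -> e * v = v -> u * v = e -> u * d * v = e.
    move=> ue ev uv; rewrite -ue -ev -!mulgA !(asc3 (Jband_rect Be Bd)).
    by rewrite ev.
  by split; apply: H.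
have [bb _] := Bb; have [cc _] := Bc.
have b2 : b * g' * b * (b * g * b) = b.
  by rewrite -!mulgA (asc2 bb) (asc3 (ebe _ Bb).2) (asc3 (Jband_rect Bb Be)).
have c1 : c * g * c * (c * g' * c) = c.
  by rewrite -!mulgA (asc2 cc) (asc3 (ebe _ Bc).1) (asc3 (Jband_rect Bc Be)).
rewrite bh in b2; rewrite -bh in c1.
have bcb : b * c = b by rewrite -{1}b2 -!mulgA cc !mulgA; move: b2; rewrite !mulgA.
have cbc : b * c = c by rewrite -{1}c1 !mulgA bb; move: c1; rewrite !mulgA.
by rewrite -bcb cbc.
Qed.

Lemma Jprod_range : range Jprod = J_class e.
Proof.
apply/seteqP; split=> [_ [[b g] _ <-]|z [ez ze]].
  rewrite /Jprod /=; have := HgP g; have := JbP b; have Be := Jband_e.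
  move: (sval b) (sval g) => {}b {}g Bb [g' [[eg ge] [gg' g'g eg' g'e]]].
  split; last by apply: (@J_le_trans _ b); [apply: J_leMl | exact: Bb.2.1].
  rewrite -gg'; apply: (@J_le_trans _ g); first exact: J_leMr.
  have {1}-> : g = e * (b * g * b) * e.
    have -> : e * (b * g * b) * e = e * b * e * g * (e * b * e).
      by rewrite !mulgA -[_ * e * g]mulgA eg -[_ * g * e]mulgA ge.
    by rewrite (Jband_rect Be Bb) eg ge.
  exact: J_le_mid.
have Jze : J_eq z e by split.
have rz : regular z by apply: regular_J Jze; exists e; rewrite !ee.
have [b [z' [[bb bz zb bJ] [zz' z'z bz' z'b]]]] := regular_completely rz.
have Bb : Jband b by split=> //; apply: J_eq_trans bJ Jze.
have Be := Jband_e.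
have beb := Jband_rect Bb Be; have ebe := Jband_rect Be Bb.
have Gz : Hgroup (e * z * e).
  exists (e * z' * e); split; first by split=> //; rewrite ?mulgA ?ee // -mulgA ee.
  have key u v : u * b = u -> b * v = v -> u * v = b -> e * u * e * (e * v * e) = e.
    move=> ub bv uv; rewrite -ub -bv -!mulgA (asc2 ee) (asc3 beb).
    by rewrite (asc2 bv) (asc2 uv) (asc3 ebe).
  by split; [exact: key | exact: key | rewrite !mulgA ee | rewrite -mulgA ee].
(* Here [b] is the identity of the subgroup containing [z]; since [b * e * b = b], the pair maps to
   [b * z * b = z]. *)
exists (exist _ b (asboolT Bb) : Jb, exist _ (e * z * e) (asboolT Gz) : Hg) => //.
by rewrite /Jprod /= -{1}bz -{1}zb -!mulgA !(asc3 beb) zb bz.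
Qed.
End Build.

Lemma idem_J_rect_DO : DO S.
Proof.
move=> x [y yx]; set e := x * y.
have ee : e * e = e by rewrite /e mulgA yx.
have Jex : J_eq e x by split; [apply: J_leMr | rewrite -{1}yx; apply: J_leMr].
exists (Jb ee), (Hg ee), (mkMul (@JprodM e ee)).
split; [exact: Jb_rectangular | exact: Hg_group | exact: Jprod_inj |].
rewrite (Jprod_range ee); apply/seteqP; split=> z [a b].
  by split; [apply: J_le_trans Jex.2 a | apply: J_le_trans b Jex.1].
by split; [apply: J_le_trans Jex.1 a | apply: J_le_trans b Jex.2].
Qed.
End DOCriterion.

(** * A membership criterion for DO and bar H, and first examples *)

Section Extension.
Variable H : finSemigroupType -> Prop.

(** The last hypothesis says that [pi] and [kappa] together are locally trivial. J-equivalent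
    idempotents have the same [kappa], so it applies to [s = e * f * e] and yields rectangularity.
    On a subgroup [kappa] is constant, so it makes [pi] injective there and the subgroup embeds in
    [T]. *)
Lemma DO_bar_extension (K T : finSemigroupType) (X : finType)
    (pi : {multiplicative K -> T}) (kappa : K -> {set X}) :
  (forall x y, kappa (x * y) = kappa x :|: kappa y) -> DO_bar H T ->
  (forall e s, e * e = e -> pi s = pi e -> kappa s = kappa e -> e * s * e = e) ->
  DO_bar H K.
Proof.
move=> kM [DT bT] lt; split.
  have kJ x y : J_le x y -> kappa y \subset kappa x.
    by move=> [[u|] [[v|] ->]] /=; rewrite ?kM ?subxx // -?finset.setUA
      ?finset.subsetUl ?finset.subsetUr // (fintype.subset_trans _ (finset.subsetUr _
        _)) ?finset.subsetUl.
  apply: idem_J_rect_DO => e f ee ff [ef fe].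
  have kef : kappa e = kappa f by apply/eqP; rewrite finset.eqEsubset !kJ.
  have pef : pi e * pi f * pi e = pi e.
    apply: (DO_idem_J_rect DT); rewrite -?gmulfM ?ee ?ff //.
    by split; apply: J_le_morph => //; apply: gmulfM.
  have := lt e (e * f * e) ee; rewrite !gmulfM pef !kM -kef !finset.setUid.
  by move=> /(_ erefl erefl); rewrite -!mulgA (asc2 ee) ee.
move=> G f gG finj; have [e [e1 einv]] := gG.
have fM : {morph (fun x => pi (f x)) : x y / x * y} by move=> x y; rewrite !gmulfM.
apply: (bT G (mkMul fM) gG) => x y /= xy.
have kE z : kappa (f z) = kappa (f e).
  have [z' [zz' _]] := einv z; apply/eqP; rewrite finset.eqEsubset.
  have zE : f z = f z * f e by rewrite -gmulfM (e1 z).2.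
  by rewrite {2}zE kM finset.subsetUr -zz' gmulfM kM finset.subsetUl.
have [y' [yy' y'y]] := einv y.
have pE : pi (f (x * y')) = pi (f e) by rewrite !gmulfM xy -!gmulfM yy'.
have := lt (f e) (f (x * y')) _ pE (kE _); rewrite -!gmulfM !(e1 _).1 (e1 _).2.
move=> /(_ erefl) /finj xye.
by rewrite -(e1 x).2 -y'y mulgA xye (e1 _).1.
Qed.

Lemma DO_bar_table T : DO_bar H T -> DO_bar H (table_of T).
Proof.
move=> VT.
apply: (@DO_bar_extension _ T void (of_tab T) (fun=> finset.set0)) => //.
  by move=> *; rewrite finset.setU0.
by move=> e s ee /(can_inj (@of_ordK T)) -> _; rewrite !ee.
Qed.

Hypothesis HH : group_pseudovariety H.

Lemma H_table T : H T -> H (table_of T).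
Proof.
apply: (pv_sub (gpv_pseudovariety HH) (f := of_tab T)).
exact: can_inj (@of_ordK T).
Qed.

Lemma H_DO_bar G : H G -> DO_bar H G.
Proof.
move=> HG; have [e [e1 einv]] := gpv_group HH HG; split.
  apply: idem_J_rect_DO => x y xx yy _.
  by rewrite (group_idem e1 einv xx) (group_idem e1 einv yy) !(e1 _).1.
by move=> K f _ finj; exact: (pv_sub (gpv_pseudovariety HH) (f := f) finj HG).
Qed.

Lemma H_trivial : H (lzero_sg 0).
Proof.
have [S HS] := pv_inhabited (gpv_pseudovariety HH).
have fM : {morph (fun _ : S => ord0 : lzero_sg 0) : x y / x * y} by [].
apply: (pv_image (gpv_pseudovariety HH) (f := mkMul fM)) HS.
apply/seteqP; split=> // x _; have /card_gt0P[s _] := @nonempty_card S.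
by exists s => //; rewrite /= [x]ord1.
Qed.

Lemma DO_bar_trivial : DO_bar H (lzero_sg 0).
Proof. exact: H_DO_bar H_trivial. Qed.

Lemma DO_bar_cset (A : finType) : DO_bar H (cset A).
Proof.
have fM : {morph (fun _ : cset A => ord0 : lzero_sg 0) : x y / x * y} by [].
apply: (@DO_bar_extension _ _ A (mkMul fM) (fun C => C)) => //.
  exact: DO_bar_trivial.
by move=> e s ee _ ->; rewrite !ee.
Qed.
End Extension.

(** * Equality of pseudowords over a pseudovariety *)

Section VEquality.
Variables (V : finSemigroupType -> Prop) (A : finType).
Implicit Types x y : pseudoword A.

Lemma Omega_projM : {morph @Omega_proj V A : x y / x * y}.
Proof. by move=> x y; apply: Omega_eqP. Qed.

Definition eqV x y := Omega_proj V x = Omega_proj V y.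

Lemma eqVM x y x' y' : eqV x x' -> eqV y y' -> eqV (x * y) (x' * y').
Proof.
by rewrite /eqV !Omega_projM => -> ->.
Qed.

Lemma eqV_ev x y : (forall T, V T -> V (table_of T)) ->
  eqV x y <-> (forall (T : finSemigroupType) (m : A -> T), V T -> ev m x = ev m y).
Proof.
move=> Vt; split=> [xy T m VT | xy].
  pose i := Marked (Vt _ VT) (fun a => to_tab T (m a)).
  have xyi := congr1 (fun w : Omega V A => coord w i) xy.
  exact: (congr1 (of_tab T) xyi).
apply: Omega_eqP => i; have := xy (base i) (mark i) (base_in i).
by rewrite -!(@coord_ev _ _ (forgetV i)).
Qed.
End VEquality.

(** * First occurrence of a letter *)

Section FirstOccurrence.
Variables (T : finSemigroupType) (c : T).

Definition midval (x y : adj1 T) : T := mul1r (mul1l x c) y.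

Lemma Some_midval x y : (Some (midval x y) : adj1 T) = x * (Some c : adj1 T) * y.
Proof. by case: x y => [x|] [y|]. Qed.

(* [inl t] is the value of a word without the marked letter; [inr (x, y)] records
   the values of the factors before and after its first occurrence, and [c] is
   the value of the letter. *)
Definition occ : Type := (T + adj1 T * adj1 T)%type.
HB.instance Definition _ := Finite.on occ.

Definition occ_val (k : occ) : T :=
  match k with inl t => t | inr (x, y) => midval x y end.

Definition occ_mul (k l : occ) : occ :=
  match k, l with
  | inl t, inl t' => inl (t * t')
  | inl t, inr (x, y) => inr ((Some t : adj1 T) * x, y)
  | inr (x, y), _ => inr (x, y * (Some (occ_val l) : adj1 T))
  end.

Fact occ_valM : {morph occ_val : k l / occ_mul k l >-> k * l}.
Proof.
have Some_inj : injective (fun t => Some t : adj1 T) by move=> ? ? [].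
by move=> [t|[x y]] [t'|[x' y']] //=; apply: Some_inj; rewrite SomeM !Some_midval !mulgA.
Qed.

Fact occ_mulA : associative occ_mul.
Proof.
move=> [t|[x y]] k l; last by rewrite /= occ_valM SomeM mulgA.
by case: k l => [t'|[x' y']] [t''|[x'' y'']] //=; rewrite ?SomeM mulgA.
Qed.

HB.instance Definition _ := isSemigroup.Build occ occ_mulA.

Fact occ_card : (0 < #|{: occ}|)%N.
Proof. by apply/card_gt0P; exists (inl c). Qed.

HB.instance Definition _ := isNonempty.Build occ occ_card.

Definition occ_sg : finSemigroupType := occ.
Definition occ_pi : {multiplicative occ_sg -> T} := @mkMul occ_sg T occ_val occ_valM.

(** In the extension criterion, [kappa] records whether the marked letter has occurred. Multiplying
    [inr (x, y)] on the right only changes [y], and does so through the value in [T]; idempotency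
    says that [y] absorbs this value. *)
Lemma DO_bar_occ H : DO_bar H T -> DO_bar H occ_sg.
Proof.
move=> VT; pose kappa (k : occ_sg) : {set unit} :=
  if k is inl _ then finset.set0 else [set: unit]%SET.
apply: (@DO_bar_extension _ _ _ _ occ_pi kappa) => //.
  by move=> [t|[x y]] [t'|[x' y']];
    rewrite /kappa /mul /= ?finset.setU0 ?finset.setTU ?finset.set0U.
move=> [t|[x y]] [t'|[x' y']] ee /= pE.
- by rewrite pE !ee.
- by move=> /(congr1 (fun C : {set unit} => tt \in C)); rewrite !inE.
- by move=> /(congr1 (fun C : {set unit} => tt \in C)); rewrite !inE.
have yy : y * (Some (midval x y) : adj1 T) = y by move: ee; rewrite /mul /= => -[].
by move=> _; rewrite /mul /= pE !yy.
Qed.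
End FirstOccurrence.

Section OccMap.
Variables (T T' : finSemigroupType) (c : T) (h : {multiplicative T -> T'}).

Definition occ_fun (k : occ_sg c) : occ_sg (h c) :=
  match k with
  | inl t => inl (h t)
  | inr (x, y) => inr (adj1_map h x, adj1_map h y)
  end.

Fact occ_funM : {morph occ_fun : k l / k * l}.
Proof.
have hM := adj1_mapM (@gmulfM _ _ h).
have hm x y : h (midval c x y) = midval (h c) (adj1_map h x) (adj1_map h y).
  by case: x y => [x|] [y|]; rewrite /midval /= ?gmulfM.
move=> [t|[x y]] [t'|[x' y']]; rewrite /mul /= ?gmulfM ?hM //.
  by rewrite /= hm.
Qed.
End OccMap.

Section AdjoinedWords.
Variable A : finType.
Notation M := (adj1 (pseudoword A)).
Implicit Types x y z : M.

Definition mev (T : finSemigroupType) (m : A -> T) x : adj1 T := adj1_map (ev m) x.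

Lemma mevM (T : finSemigroupType) (m : A -> T) : {morph mev m : x y / x * y}.
Proof. exact: adj1_mapM (evM m). Qed.

Lemma mev_inj x y : (forall (T : finSemigroupType) (m : A -> T), mev m x = mev m y) ->
  x = y.
Proof.
case: x y => [x|] [y|] //= xy; first by congr Some; apply: pseudoword_eqP => T m;
  case: (xy T m).
  by have := xy (lzero_sg 0) (fun=> ord0).
by have := xy (lzero_sg 0) (fun=> ord0).
Qed.

Definition mcontent x : {set A} := oapp (@content A) finset.set0 x.

Lemma mcontentM x y : mcontent (x * y) = mcontent x :|: mcontent y.
Proof. by case: x y => [x|] [y|] /=; rewrite ?contentM ?finset.setU0 ?finset.set0U. Qed.

Definition gen (a : A) : M := Some (Omega_gen allS a).

Lemma mcontent_gen a : mcontent (gen a) = [set a]%SET.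
Proof. exact: content_gen. Qed.

Lemma mev_gen (T : finSemigroupType) (m : A -> T) a : mev m (gen a) = Some (m a).
Proof. by rewrite /mev /= ev_gen. Qed.

(** Naturality along the map to the trivial semigroup shows that the values are [None] everywhere or
    nowhere. In the second case they are the coordinates of a pseudoword, with [u] supplying the
    default for [odflt]. *)
Lemma natural_values (X : forall T : finSemigroupType, (A -> T) -> adj1 T) (u :
  pseudoword A) :
  (forall (T T' : finSemigroupType) (m : A -> T) (h : {multiplicative T -> T'}),
     adj1_map h (X T m) = X T' (fun a => h (m a))) ->
  exists x, forall (T : finSemigroupType) (m : A -> T), mev m x = X T m.
Proof.
move=> Xnat; pose t0 : lzero_sg 0 := ord0.
have cM (T : finSemigroupType) : {morph (fun _ : T => t0) : x y / x * y} by [].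
case X0 : (X (lzero_sg 0) (fun=> t0)) => [t|]; last first.
  exists None => T m; have := Xnat _ _ m (mkMul (cM T)); rewrite /= X0.
  by case: (X T m).
have Xsome (T : finSemigroupType) (m : A -> T) d : Some (odflt d (X T m)) = X T m.
  by have := Xnat _ _ m (mkMul (cM T)); rewrite /= X0; case: (X T m).
have nat_x : @natural_family allS A (fun i => odflt (coord u i) (X (base i) (mark i))).
  move=> i j h hm; have := Xnat _ _ (mark i) h.
  have -> : (fun a => h (mark i a)) = mark j.
    by apply: functional_extensionality_dep.
  by rewrite -(Xsome _ (mark i) (coord u i)) /= => <-.
exists (Some (mkOmega nat_x)) => T m.
have := Xnat _ _ (fun a => to_tab T (m a)) (of_tab T).
have -> : (fun a => of_tab T (to_tab T (m a))) = m.
  by apply: functional_extensionality_dep => a; apply: to_ordK.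
by move=> <-; rewrite -(Xsome _ _ (coord u (tmark m))).
Qed.

Section Occ.
Variables (T : finSemigroupType) (m : A -> T) (c : A).

Definition occ_mark (b : A) : occ_sg (m c) :=
  if b == c then inr (None, None) else inl (m b).

Lemma occ_pi_ev u : occ_pi (m c) (ev occ_mark u) = ev m u.
Proof. by apply: ev_nat => b; rewrite /occ_mark; case: eqP => [->|]. Qed.

Lemma ev_occ_notin u : c \notin content u -> ev occ_mark u = inl (ev m u).
Proof.
pose n b := (occ_mark b, m b).
have := @ev_content_ind _ _ n (fun p C => c \notin C -> p.1 = inl p.2) u.
rewrite ev_pair; apply=> [b|[k s] [l t] C D /= kC lD].
  by rewrite /= /occ_mark inE eq_sym; case: eqP.
by rewrite inE negb_or => /andP[/kC -> /lD ->].
Qed.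

Lemma ev_occ_in u : c \in content u ->
  exists p : adj1 T * adj1 T, ev occ_mark u = inr p.
Proof.
apply: (@ev_content_ind _ _ occ_mark
  (fun k C => c \in C -> exists p : adj1 T * adj1 T, k = inr p)) => [b|k l C D kC lD].
  by rewrite inE /occ_mark eq_sym => ->; exists (None, None).
rewrite inE; case: k kC => [t|[p q]] kC; last by move=> _; eexists.
by case/orP => [/kC[//]|/lD[[p q] ->]]; eexists.
Qed.

Lemma mev_occ x y : c \notin mcontent x ->
  mev occ_mark (x * gen c * y) = Some (inr (mev m x, mev m y)).
Proof.
have occ_c : ev occ_mark (Omega_gen allS c) = inr (None, None).
  by rewrite ev_gen /occ_mark eqxx.
case: x => [x|] xc; case: y => [y|]; rewrite /mev /= ?evM occ_c ?(ev_occ_notin xc);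
  congr Some; rewrite /mul /= ?mulx1 //.
all: congr (inr (_, _)); exact: (congr1 Some (occ_pi_ev _)).
Qed.
End Occ.

(* The two factors are read off the values in the semigroups [occ_sg]. *)
Lemma first_occurrence (c : A) z : c \in mcontent z ->
  exists x y, z = x * gen c * y /\ c \notin mcontent x.
Proof.
case: z => [u|]; last by rewrite inE.
rewrite /= => cu.
pose F (T : finSemigroupType) (m : A -> T) : adj1 T * adj1 T :=
  if ev (occ_mark m c) u is inr p then p else (None, None).
have Fnat (T T' : finSemigroupType) (m : A -> T) (h : {multiplicative T -> T'}) :
    (adj1_map h (F T m).1, adj1_map h (F T m).2) = F T' (fun a => h (m a)).
  rewrite /F -(@ev_nat _ _ _ (occ_mark m c) _ (mkMul (@occ_funM _ _ (m c) h))).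
    by have [[p q] ->] := ev_occ_in m cu.
  by move=> b; rewrite /occ_mark /=; case: eqP.
have [|x xE] := @natural_values (fun T m => (F T m).1) u.
  by move=> T T' m h; rewrite -Fnat.
have [|y yE] := @natural_values (fun T m => (F T m).2) u.
  by move=> T T' m h; rewrite -Fnat.
exists x, y; split.
  apply: mev_inj => T m; rewrite !mevM mev_gen xE yE /F /mev /= -(occ_pi_ev m c).
  by have [[p q] ->] := ev_occ_in m cu; rewrite /= Some_midval.
have := xE (cset A) (fun a => [set a]%SET); rewrite /F.
have [[x' y'] k] := ev_occ_in (fun a => [set a]%SET : cset A) cu; rewrite k => x'E.
have -> : mcontent x = odflt finset.set0 (x' : option {set A}).
  by rewrite -[x']x'E; case: (x).
(* Invariant: as long as the letter has not occurred, the whole value avoids [c]; afterwards the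
   recorded prefix does. *)
pose Q (k : occ_sg ([set c]%SET : cset A)) := c \notin
  match k with inl t => t : {set A} | inr (p, _) => odflt finset.set0 (p :
    option {set A}) end.
have : Q (ev (occ_mark (fun a => [set a]%SET : cset A) c) u).
  apply: (@ev_ind _ _ _ Q) => [b|[s|[s s']] [t|[t t']]].
  - by rewrite /Q /occ_mark; case: (eqVneq b c) => [_|bc]; rewrite ?inE // eq_sym.
  - by rewrite /Q /mul /= /mul /= inE => /negPf -> /negPf ->.
  - rewrite /Q /mul /=; case: t => [t|] //= cs ct.
    by rewrite /mul /= inE negb_or cs.
  - by [].
  - by [].
by rewrite k.
Qed.
End AdjoinedWords.

(** * Reversal *)

Definition opsg (S : Type) : Type := S.
HB.instance Definition _ (S : choiceType) := Choice.on (opsg S).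
HB.instance Definition _ (S : finType) := Finite.copy (opsg S) S.

Section Opposite.
Variable S : semigroupType.
Definition op_mul (x y : opsg S) : opsg S := (y : S) * (x : S).
Fact op_mulA : associative op_mul.
Proof. by move=> x y z; rewrite /op_mul mulgA. Qed.
HB.instance Definition _ := isSemigroup.Build (opsg S) op_mulA.
End Opposite.

Fact op_card (S : finSemigroupType) : (0 < #|{: opsg S}|)%N.
Proof. exact: nonempty_card. Qed.
HB.instance Definition _ (S : finSemigroupType) := isNonempty.Build (opsg S) (op_card S).

Section OpMorphism.
Variables (S T : semigroupType) (h : {multiplicative S -> T}).
Fact op_morphM : {morph (h : opsg S -> opsg T) : x y / x * y}.
Proof. by move=> x y; rewrite [RHS]/mul /= /op_mul -gmulfM. Qed.
Definition op_morph : {multiplicative opsg S -> opsg T} := mkMul op_morphM.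
End OpMorphism.

Lemma J_le_op (S : semigroupType) (x y : opsg S) : J_le x y -> @J_le S x y.
Proof.
move=> [u [v ->]]; exists v, u.
by case: u v => [u|] [v|]; rewrite /= /mul //= /op_mul mulgA.
Qed.

(** A subgroup of the opposite semigroup, composed with inversion, becomes a subgroup of [S]
    isomorphic to the same group. *)
Lemma DO_bar_op H (S : finSemigroupType) : DO_bar H S -> DO_bar H (opsg S).
Proof.
move=> [DS bS]; split.
  apply: idem_J_rect_DO => e f ee ff [/J_le_op ef /J_le_op fe].
  change ((e : S) * ((f : S) * (e : S)) = e); rewrite mulgA.
  by apply: (DO_idem_J_rect DS).
move=> G f gG finj; have [e [e1 einv]] := gG.
have [i iP] := choice einv.
have iM x y : i (x * y) = i y * i x.
  have [xx _] := iP x; have [yy _] := iP y; have [_ xy] := iP (x * y).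
  have E : x * y * (i y * i x) = e by rewrite mulgA -[x * y * i y]mulgA yy (e1 _).2 xx.
  by rewrite -[LHS](e1 _).2 -E mulgA xy (e1 _).1.
have fM : {morph (fun x => f (i x) : S) : x y / x * y}.
  by move=> x y; rewrite iM gmulfM.
apply: (bS G (mkMul fM) gG) => x y /= /finj xy.
have [xx x'x] := iP x; have [yy y'y] := iP y.
by rewrite -(e1 x).2 -y'y -xy mulgA xx (e1 _).1.
Qed.

Section Reversal.
Variable A : finType.
Notation M := (adj1 (pseudoword A)).

Fact rev_natural (u : pseudoword A) :
  @natural_family allS A (fun i => ev (mark i : A -> opsg (base i)) u).
Proof.
move=> i j h hm.
exact: (@ev_nat _ (opsg (base i)) (opsg (base j)) _ _ (op_morph h)).
Qed.

(** Reversal is defined by evaluating [u] in the opposite of each semigroup. *)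
Definition pwrev (u : pseudoword A) : pseudoword A := mkOmega (rev_natural u).

Lemma ev_rev (T : finSemigroupType) (m : A -> T) u : ev m (pwrev u) = ev (m : A ->
  opsg T) u.
Proof.
apply: (@ev_nat _ (opsg (table_of T)) (opsg T) _ _ (op_morph (of_tab T))) => a.
exact: (@to_ordK T (m a)).
Qed.

Lemma pwrevK : involutive pwrev.
Proof.
move=> u; apply: pseudoword_eqP => T m; rewrite !ev_rev.
have hM : {morph (id : opsg (opsg T) -> T) : x y / x * y} by [].
exact: (@ev_nat _ (opsg (opsg T)) T m m (mkMul hM)).
Qed.

Lemma pwrevM u v : pwrev (u * v) = pwrev v * pwrev u.
Proof. by apply: pseudoword_eqP => T m; rewrite evM !ev_rev evM. Qed.

Lemma pwrev_gen a : pwrev (Omega_gen allS a) = Omega_gen allS a.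
Proof. by apply: pseudoword_eqP => T m; rewrite ev_rev !ev_gen. Qed.

Lemma content_rev u : content (pwrev u) = content u.
Proof.
rewrite /content ev_rev.
have hM : {morph (id : opsg (cset A) -> cset A) : x y / x * y}.
  by move=> x y; apply: finset.setUC.
exact: (@ev_nat _ (opsg (cset A)) (cset A) _ _ (mkMul hM)).
Qed.

Definition mrev (x : M) : M := omap pwrev x.

Lemma mrevM x y : mrev (x * y) = mrev y * mrev x.
Proof. by case: x y => [x|] [y|] //; rewrite /mrev /= pwrevM. Qed.

Lemma mrevK : involutive mrev.
Proof. by case=> // x; rewrite /mrev /= pwrevK. Qed.

Lemma mrev_gen a : mrev (gen a) = gen a.
Proof. by rewrite /mrev /= pwrev_gen. Qed.

Lemma mcontent_rev x : mcontent (mrev x) = mcontent x.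
Proof. by case: x => //= x; rewrite content_rev. Qed.

End Reversal.

(** * Equality over V with an adjoined identity *)

Section MEquality.
Variables (V : finSemigroupType -> Prop) (A : finType).
Notation M := (adj1 (pseudoword A)).
Implicit Types x y z : M.

Definition eqM x y := adj1_map (@Omega_proj V A) x = adj1_map (@Omega_proj V A) y.

Lemma eqMM x y x' y' : eqM x x' -> eqM y y' -> eqM (x * y) (x' * y').
Proof.
by rewrite /eqM !(adj1_mapM (@Omega_projM V A)) => -> ->.
Qed.

Lemma eqM_sym x y : eqM x y -> eqM y x.
Proof. exact: esym. Qed.

Lemma eqM_trans y x z : eqM x y -> eqM y z -> eqM x z.
Proof. exact: etrans. Qed.

Lemma eqM_Some (u v : pseudoword A) : eqM (Some u) (Some v) <-> eqV V u v.
Proof. by split=> [/Some_inj|uv] //; rewrite /eqM /adj1_map /= uv. Qed.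

Hypothesis Vt : forall T, V T -> V (table_of T).

Lemma eqM_ev x y (T : finSemigroupType) (m : A -> T) : V T -> eqM x y -> mev m x = mev m y.
Proof.
by move=> VT; case: x y => [x|] [y|] // /eqM_Some xy; congr Some; apply: (eqV_ev x y Vt).1.
Qed.

Lemma ev_eqM x y : (exists T, V T) ->
  (forall (T : finSemigroupType) (m : A -> T), V T -> mev m x = mev m y) -> eqM x y.
Proof.
move=> [S VS]; have /card_gt0P [s _] := @nonempty_card S.
case: x y => [x|] [y|] // xy; try by have := xy S (fun=> s) VS.
by apply/eqM_Some/eqV_ev => // T m VT; case: (xy T m VT).
Qed.
End MEquality.

Section DOBar.
Variables (H : finSemigroupType -> Prop) (HH : group_pseudovariety H) (A : finType).
Notation V := (DO_bar H).
Notation M := (adj1 (pseudoword A)).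
Implicit Types x y z : M.

Let V_ex : exists T, V T. Proof. by exists (lzero_sg 0); apply: DO_bar_trivial. Qed.

Lemma eqM_content x y : eqM V x y -> mcontent x = mcontent y.
Proof.
move=> /(eqM_ev (@DO_bar_table H) (fun a => [set a]%SET : cset A) (DO_bar_cset HH A)).
by case: x y => [x|] [y|] //= [].
Qed.

Lemma eqM_H x y : eqM V x y -> eqM H x y.
Proof.
move=> xy; apply: ev_eqM; [exact: H_table | by exists (lzero_sg 0); apply: H_trivial |].
by move=> T m HT; apply: eqM_ev xy; [exact: DO_bar_table | exact: H_DO_bar].
Qed.

(** Whenever [T] is in V, so is [occ_sg (m c)]; values there display the values in [T] of both
    factors. *)
Lemma first_occurrence_uniq c x y x' y' :
  c \notin mcontent x -> c \notin mcontent x' ->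
  eqM V (x * gen c * y) (x' * gen c * y') -> eqM V x x' /\ eqM V y y'.
Proof.
move=> cx cx' xy.
suff k (T : finSemigroupType) (m : A -> T) : V T ->
  mev m x = mev m x' /\ mev m y = mev m y'.
  by split; apply: ev_eqM V_ex _ => [|T m VT]; try exact: DO_bar_table; case: (k T m VT).
move=> VT; have := eqM_ev (@DO_bar_table H) (occ_mark m c) (DO_bar_occ (m c) VT) xy.
by rewrite !mev_occ // => -[].
Qed.

Lemma eqM_rev x y : eqM V x y -> eqM V (mrev x) (mrev y).
Proof.
move=> xy; apply: ev_eqM V_ex _ => [|T m VT]; first exact: DO_bar_table.
have := eqM_ev (@DO_bar_table H) (m : A -> opsg T) (DO_bar_op VT) xy.
by case: x y xy => [x|] [y|] //= _; rewrite !ev_rev.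
Qed.

Lemma last_occurrence_uniq c x y x' y' :
  c \notin mcontent x -> c \notin mcontent x' ->
  eqM V (y * gen c * x) (y' * gen c * x') -> eqM V x x' /\ eqM V y y'.
Proof.
move=> cx cx' /eqM_rev; rewrite !mrevM !mrev_gen !mulgA => /first_occurrence_uniq[].
- by rewrite mcontent_rev.
- by rewrite mcontent_rev.
by move=> /eqM_rev + /eqM_rev; rewrite !mrevK.
Qed.
End DOBar.

(** * Omega powers *)

Section JFilter.
Variables (S : finSemigroupType) (e : S).
Hypotheses (rectS : idem_J_rect S) (ee : e * e = e).

Lemma J_le_idem s : J_le e s -> exists p q, [/\ e = p * s * q, e * p = p & q * e = q].
Proof.
move=> [u [v eE]]; exists (mul1r e u), (mul1l v e); split.
- have -> : mul1r e u * s * mul1l v e = e * mul1r (mul1l u s) v * e.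
    by case: u v {eE} => [u|] [v|]; rewrite /= ?mulgA.
  by rewrite -eE !ee.
- by case: u {eE} => [u|] /=; rewrite ?mulgA ee.
- by case: v {eE} => [v|] /=; rewrite -?mulgA ee.
Qed.

(** With [e = p * s * q = p' * t * q'], the elements [f = q * p * s] and [g = t * q' * p'] are
    idempotents J-equivalent to [e], and [f = f * g * f] has [s * t] as a factor. *)
Lemma J_le_mul s t : J_le e s -> J_le e t -> J_le e (s * t).
Proof.
move=> /J_le_idem[p [q [eE ep qe]]] /J_le_idem[p' [q' [eE' ep' qe']]].
pose f := q * p * s; pose g := t * q' * p'.
have Jf : J_eq e f.
  split; last by rewrite /f -{1}qe -!mulgA; exists (Some q), (Some (p * s));
    rewrite /= -!mulgA.
  have -> : e = p * s * f * q by rewrite -{1}ee {1 2}eE /f -!mulgA.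
  exact: J_le_mid.
have Jg : J_eq e g.
  split; last by rewrite /g -{1}qe' -!mulgA; exists (Some (t * q')), (Some p');
    rewrite /= -!mulgA.
  have -> : e = p' * g * (t * q') by rewrite -{1}ee {1 2}eE' /g -!mulgA.
  exact: J_le_mid.
have ff : f * f = f.
  have -> : f * f = q * (p * s * q) * p * s by rewrite /f !mulgA.
  by rewrite -eE qe.
have gg : g * g = g.
  have -> : g * g = t * q' * (p' * t * q') * p' by rewrite /g !mulgA.
  by rewrite -eE' -mulgA ep'.
apply: J_le_trans Jf.1 _.
rewrite -(rectS ff gg (J_eq_trans (J_eq_sym Jf) Jg)).
have -> : f * g * f = (q * p) * (s * t) * (q' * p' * f) by rewrite /f /g !mulgA.
exact: J_le_mid.
Qed.
End JFilter.

(** Here [gam s] is the group component of [e * s * e] in the decomposition of the J-class of [e] as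
    band times group. The band component of [e * s * f] is fixed by [e] and [f]. *)
Lemma J_class_cocycle (H : finSemigroupType -> Prop) (S : finSemigroupType) (e : S) :
  DO_bar H S -> e * e = e ->
  exists (G : finSemigroupType) (gam : S -> G), H G /\
    (forall s t, J_le e s -> J_le e t -> gam (s * t) = gam s * gam t) /\
    (forall s t f, J_le e s -> J_le e t -> f * f = f -> J_eq e f -> gam s = gam t ->
       e * s * f = e * t * f).
Proof.
move=> [DS bS] ee; have rectS := DO_idem_J_rect DS.
have [B [G [h [rB gG h_inj hJ]]]] := DS e (ex_intro _ e (etrans (congr1 (mul^~ e) ee) ee)).
have HG : H G.
  have /card_gt0P [b _] := @nonempty_card B.
  have kM : {morph (fun g => h (b, g)) : x y / x * y}.
    by move=> x y; rewrite -gmulfM -[(b, x) * _]/(b * b, x * y) (rB b b).1.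
  by apply: (bS G (mkMul kM)) => // x y /= /h_inj[].
have [i [i1 iV]] := gG.
have bcd (b c d : B) : b * c * d = b * d.
  by rewrite -{1}(rB d b).2 !mulgA -[b * c * d]mulgA (rB b (c * d)).2.
have hP z : J_eq z e -> exists p, h p = z.
  by move=> [ze ez]; have : J_class e z by []; rewrite -hJ => -[p _]; exists p.
have eJ := J_le_refl e.
have [[b0 g0] h0] := hP e (conj eJ eJ).
have g0i : g0 = i.
  by apply: (group_idem i1 iV); have := ee; rewrite -h0 -gmulfM => /h_inj[].
subst g0.
have eJl s : J_le e s -> J_eq (e * s) e.
  by move=> es; split; [apply: J_leMr | apply: J_le_mul].
have eJr s : J_le e s -> J_eq (s * e) e.
  by move=> es; split; [apply: J_leMl | apply: J_le_mul].
have eJlr s : J_le e s -> J_eq (e * s * e) e.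
  by move=> es; split; [apply: J_leMl | apply: J_le_mul => //; apply: J_le_mul].
(* Elements not J-above [e] receive a default value. *)
have ex_gam s : exists p, J_le e s -> h p = e * s * e.
  have [es|es] := pselect (J_le e s); last by exists (b0, i).
  by have [p hp] := hP _ (eJlr _ es); exists p.
have [gam gamP] := choice ex_gam.
have gamE s : J_le e s -> e * s * e = h (b0, (gam s).2).
  move=> es; have {1}-> : e * s * e = e * (e * s * e) * e.
    by rewrite -!mulgA ee !mulgA ee.
  rewrite -(gamP _ es) -h0 -!gmulfM; congr (h (_, _)); case: (gam s) => b g /=.
    exact: (rB _ _).2.
  by rewrite (i1 _).1 (i1 _).2.
exists G, (fun s => (gam s).2); split=> //; split=> [s t es et|s t f es et ff ef gst].
  have [[b1 g1] h1] := hP _ (eJl _ es); have [[b2 g2] h2] := hP _ (eJr _ et).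
  have gs : (gam s).2 = g1.
    have := gamP _ es; rewrite -h1 -{1}h0 -gmulfM => /h_inj; case: (gam s) => b g [_ ->].
    exact: (i1 _).2.
  have gt : (gam t).2 = g2.
    have := gamP _ et; rewrite -mulgA -h2 -{1}h0 -gmulfM => /h_inj;
      case: (gam t) => b g [_ ->].
    exact: (i1 _).1.
  have := gamP _ (J_le_mul rectS ee es et).
  have -> : e * (s * t) * e = e * s * (t * e) by rewrite !mulgA.
  by rewrite -h1 -h2 -gmulfM => /h_inj; rewrite gs gt; case: (gam _) => b g [].
(* The middle [e] can be inserted because idempotents have trivial group component and inner band
   factors disappear. *)
have efs z : J_le e z -> e * z * f = e * z * e * f.
  move=> ez; have -> : e * z * e * f = e * z * (e * f) by rewrite !mulgA.
  have [[b1 g1] h1] := hP _ (eJl _ ez); have [[c k] hf] := hP _ (J_eq_sym ef).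
  have ki : k = i by apply: (group_idem i1 iV); have := ff; rewrite -hf -gmulfM => /h_inj[].
  rewrite -h1 -hf -h0 -!gmulfM ki; congr (h (_, _)); first by rewrite mulgA bcd.
  by rewrite /= !(i1 _).1.
by rewrite (efs s) // (efs t) // !gamE // gst.
Qed.

Lemma idempotent_power_morph (S T : semigroupType) (h : {multiplicative S -> T}) x e :
  idempotent_power x e -> idempotent_power (h x) (h e).
Proof.
move=> [ee [k ek]]; split; first by rewrite -gmulfM ee.
by exists k; rewrite {}ek {ee}; elim: k => //= k <-; rewrite gmulfM.
Qed.

Section OmegaPower.
Variable A : finType.
Implicit Types u w : pseudoword A.

Fact omega_natural u : @natural_family allS A
  (fun i => sval (cid (idempotent_power_ex (coord u i)))).
Proof.
move=> i j h hm; case: cid => e eP /=; case: cid => f /= fP.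
by apply: idempotent_power_uniq fP; rewrite -(coordP u hm); apply: idempotent_power_morph.
Qed.

Definition omega u : pseudoword A := mkOmega (omega_natural u).

Lemma ev_omega (T : finSemigroupType) (m : A -> T) u :
  idempotent_power (ev m u) (ev m (omega u)).
Proof.
apply: idempotent_power_morph; rewrite [coord (omega u) _]/coord /=; exact: svalP.
Qed.

Lemma ev_omega_uniq (T : finSemigroupType) (m : A -> T) u v :
  ev m u = ev m v -> ev m (omega u) = ev m (omega v).
Proof.
move=> uv; apply: idempotent_power_uniq (ev_omega m u) _.
by rewrite uv; apply: ev_omega.
Qed.

Lemma content_omega u : content (omega u) = content u.
Proof.
have [_ [k kE]] := ev_omega (fun a => [set a]%SET : cset A) u.
apply: etrans kE _; rewrite -/(content u); elim: k => //= k IH.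
by rewrite IH; apply: finset.setUid.
Qed.

Lemma sigma_word_omega sigma u :
  sigma_word (add_omega sigma) u -> sigma_word (add_omega sigma) (omega u).
Proof.
move=> su; have [w wE] := omega_wordE.
have ww : omega_word w by rewrite wE.
have -> : omega u = interp w (fun=> u).
  apply: Omega_eqP => i; apply: (@idempotent_power_uniq _ (coord u i)).
    by rewrite [coord (omega u) _]/coord /=; apply: svalP.
  exact: ww (mark_subst (fun=> u) i).
by apply: sigma_word_op => //; right.
Qed.

Lemma sigma_word_mul sigma u w : implicit_signature sigma ->
  sigma_word sigma u -> sigma_word sigma w -> sigma_word sigma (u * w).
Proof.
move=> s2 su sw.
have -> : u * w = interp binary_mul (fun k : 'I_2 => if k == ord0 then u else w).
  exact: Omega_eqP.
by apply: sigma_word_op => // k; case: ifP.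
Qed.
End OmegaPower.

Lemma J_le_spow (S : semigroupType) (x : S) k : J_le (spow x k) x.
Proof. by case: k => [|k]; [apply: J_le_refl | apply: J_leMr]. Qed.

Section DOBarOmega.
Variables (H : finSemigroupType -> Prop) (HH : group_pseudovariety H) (A : finType).
Implicit Types u v x y : pseudoword A.

(** Each letter of [x] is J-above its omega power, and in DO the elements J-above an idempotent are
    closed under products. *)
Lemma content_J_le (T : finSemigroupType) (m : A -> T) x u :
  DO T -> content u \subset content x -> J_le (ev m (omega x)) (ev m u).
Proof.
move=> DT.
have [ee [k ek]] := ev_omega m x; set e := ev m (omega x) in ee ek *.
have ex b : b \in content x -> J_le e (m b).
  move=> bx; apply: (@J_le_trans _ (ev m x)); first by rewrite ek; apply: J_le_spow.
  move: b bx; apply: (@ev_content_ind _ _ m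
    (fun t C => forall b : A, b \in C -> J_le t (m b))) => [a b|s t C D sC tD b].
    by rewrite inE => /eqP ->; apply: J_le_refl.
  rewrite inE => /orP[/sC|/tD]; apply: J_le_trans; [exact: J_leMr | exact: J_leMl].
apply: (@ev_content_ind _ _ m (fun t C => C \subset content x -> J_le e t)).
  by move=> a; rewrite finset.sub1set => /ex.
move=> s t C D sC tD; rewrite finset.subUset => /andP[/sC es /tD et].
by apply: J_le_mul => //; apply: DO_idem_J_rect.
Qed.

(** On pseudowords over the content of [x], the cocycle [gam] at the omega power of [x] is
    evaluation in a group of H, so it cannot separate [u] from [v]. Equal contents make the two
    omega powers J-equivalent, and [gam] then determines the sandwich. *)
Lemma omega_sandwich x y u v : content x = content y ->
  content u \subset content x -> content v \subset content x -> eqV H u v ->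
  eqV (DO_bar H) (omega x * u * omega y) (omega x * v * omega y).
Proof.
move=> xy ux vx uv; apply/eqV_ev => [|T m VT]; first exact: DO_bar_table.
have DT := VT.1; rewrite !evM.
have [ee _] := ev_omega m x; have [ff _] := ev_omega m y.
have [G [gam [HG [gamM gamE]]]] := J_class_cocycle VT ee.
have gam_ev w : content w \subset content x ->
    gam (ev m w) = ev (fun a => gam (m a)) w.
  pose n a := (m a, gam (m a)).
  have := @ev_content_ind _ _ n (fun p C => C \subset content x ->
    J_le (ev m (omega x)) p.1 /\ gam p.1 = p.2) w; rewrite ev_pair => Q wx.
  apply: (proj2 (Q _ _ wx)) => [a ax|[s g] [t g'] C D sC tD] /=.
    by split=> //; rewrite -(ev_gen m); apply: content_J_le; rewrite ?content_gen.
  rewrite finset.subUset => /andP[/sC[/= es <-] /tD[/= et <-]].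
  by split; [apply: J_le_mul => //; apply: DO_idem_J_rect | apply: gamM].
apply: gamE => //; try exact: content_J_le.
  by split; apply: content_J_le; rewrite // content_omega xy.
by rewrite !gam_ev //; apply: (eqV_ev u v (H_table HH)).1.
Qed.

Lemma eqV_omega V x y : (forall T, V T -> V (table_of T)) ->
  eqV V x y -> eqV V (omega x) (omega y).
Proof.
move=> Vt xy; apply/eqV_ev => // T m VT; apply: ev_omega_uniq.
exact: (eqV_ev x y Vt).1.
Qed.
End DOBarOmega.

(** * Equality over H *)

Section GroupValue.
Variables (G : finSemigroupType) (e : G).
Hypothesis e1 : forall x, e * x = x /\ x * e = x.

Definition gval (x : adj1 G) : G := odflt e x.

Lemma gvalM : {morph gval : x y / x * y}.
Proof.
by move=> [x|] [y|] //=; rewrite /gval /= ?(e1 _).1 ?(e1 _).2.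
Qed.
End GroupValue.

Section HEquality.
Variables (H : finSemigroupType -> Prop) (HH : group_pseudovariety H) (A : finType).
Implicit Types u v w : pseudoword A.

Lemma eqV_H u v : (forall (G : finSemigroupType) (e : G) (m : A -> G),
    (forall x, e * x = x /\ x * e = x) -> (forall x, exists y, x * y = e /\ y * x = e) ->
    ev m u = ev m v) -> eqV H u v.
Proof.
move=> uv; apply/eqV_ev => [|T m HT]; first exact: H_table.
by have [e [e1 einv]] := gpv_group HH HT; apply: uv e1 einv.
Qed.

Lemma ev_omega_group (G : finSemigroupType) (e : G) (m : A -> G) u :
  (forall x, e * x = x /\ x * e = x) -> (forall x, exists y, x * y = e /\ y * x = e) ->
  ev m (omega u) = e.
Proof. by move=> e1 einv; apply: group_idem e1 einv (ev_omega m u).1. Qed.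

Lemma omega_sandwich_H (x y : pseudoword A) u : eqV H (omega x * u * omega y) u.
Proof.
apply: eqV_H => G e m e1 einv.
by rewrite !evM !(ev_omega_group _ _ e1 einv) (e1 _).1 (e1 _).2.
Qed.

(* A cyclic conjugate of the trivial element of a group is trivial. *)
Lemma conjugate_trivial (p q : adj1 (pseudoword A)) (x y : pseudoword A) u w :
  (Some w : adj1 (pseudoword A)) = (Some (u * omega y) : adj1 (pseudoword A)) * (q * p)
    * (Some (omega x * u) : adj1 (pseudoword A)) ->
  let g := p * (Some u : adj1 (pseudoword A)) * q in eqM H (g * g) g -> eqV H w u.
Proof.
move=> wE g gg; apply/eqV_ev => [|T m HT]; first exact: H_table.
have [e [e1 einv]] := gpv_group HH HT.
have := eqM_ev (H_table HH) m HT gg; rewrite !mevM.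
move=> /(congr1 (gval e)); rewrite !gvalM //.
have := congr1 (fun x => gval e (mev m x)) wE; rewrite !mevM !gvalM //.
rewrite /gval /= !evM !(ev_omega_group _ _ e1 einv) (e1 _).1 (e1 _).2 -/(gval e (mev m
  p)) -/(gval e (mev m q)).
(* With [s], [t], [z] the values of [p], [q], [u], the idempotent [s * z * t] is trivial, hence so
   is its conjugate [z * t * s], and [w] takes the value [z * t * s * z = z]. *)
move: (gval e (mev m p)) (gval e (mev m q)) (ev m u) (ev m w) => s t z _ ->.
move=> /(group_idem e1 einv) szt; have [s' [ss' s's]] := einv s.
have tsz : z * t * s = e.
  by rewrite -[z](e1 _).1 -s's -!mulgA [s * (z * _)]mulgA [s * z * _]mulgA szt (e1 _).1.
by rewrite mulgA tsz (e1 _).1.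
Qed.
End HEquality.

(** If peeling off good factors never ends, two of the first [#|F|+1] prefixes have the same [val].
    The earlier one is [p], and [b] is what the later one adds to it. *)
Lemma iterate_factorization (X : Type) (op : X -> X -> X) (F : finType) (val : X -> F)
    (Good Rest Done : X -> Prop) : associative op ->
  (forall x y, Good x -> Good y -> Good (op x y)) ->
  (forall x y, Good x -> Done y -> Done (op x y)) ->
  (forall y, Rest y -> (exists z y', [/\ y = op z y', Good z & Rest y']) \/ Done y) ->
  forall y, Rest y -> Done y \/
    exists p b y', [/\ y = op p y', Good p, Good b, Rest y' & val (op p b) = val p].
Proof.
move=> opA Gop Dop step y0 R0; have [D0|nD0] := pselect (Done y0); first by left.
right; pose T y := Rest y /\ ~ Done y.
have stepT y : exists zy : X * X, T y -> [/\ y = op zy.1 zy.2, Good zy.1 & T zy.2].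
  have [[Ry nDy]|nT] := pselect (T y); last by exists (y, y).
  have [[z [y' [yE Gz Ry']]]|//] := step y Ry.
  exists (z, y') => _; split=> //; split=> // Dy'; apply: nDy.
  by rewrite yE; apply: Dop.
have [g gP] := choice stepT; pose Y k := iter k (fun y => (g y).2) y0.
have TY k : T (Y k) by elim: k => // k /gP[].
pose Z k := (g (Y k)).1; have YE k : Y k = op (Z k) (Y k.+1) by have [] := gP _ (TY k).
have GZ k : Good (Z k) by have [] := gP _ (TY k).
pose P := fix P k := if k is l.+1 then op (P l) (Z l.+1) else Z 0%N.
have GP k : Good (P k) by elim: k => //= k IH; apply: Gop.
have PE k : y0 = op (P k) (Y k.+1).
  by elim: k => [|k IH]; [exact: (YE 0%N) | rewrite {1}IH YE opA].
have [a [b [ab fab]]] : exists a b, (a < b)%N /\ val (P a) = val (P b).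
  have /injectivePn[a [b ab fab]] : ~~ injectiveb (fun k : 'I_#|F|.+1 => val (P k)).
    by apply/negP => /injectiveP /leq_card; rewrite card_ord ltnn.
  move: ab; rewrite neq_ltn => /orP[] ab; first by exists a, b.
  by exists b, a.
have [c [Gc Pb]] : exists c, Good c /\ P b = op (P a) c.
  elim: b ab {fab} => // b IH; rewrite ltnS leq_eqVlt => /orP[/eqP ->|/IH[c [Gc Pb]]].
    by exists (Z b.+1).
  by exists (op c (Z b.+1)); split; [apply: Gop | rewrite opA -Pb].
(* The remainder starts right after [P a]: the factor [c] is not removed from it, but only serves as
   something that [P a] absorbs under [val]. *)
exists (P a), c, (Y a.+1); split=> //; first exact: (TY _).1.
by rewrite -Pb fab.
Qed.

(** * Reduction to systems over H *)

Section Solvable.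
Variables (sigma : opset) (H : finSemigroupType -> Prop) (A : finType).
Hypotheses (sigmaM : implicit_signature sigma) (HH : group_pseudovariety H).
Variables (S : finSemigroupType) (psi : A -> S).
Hypothesis psi_gen : forall u a, ev psi u = psi a -> u = Omega_gen allS a.
Hypothesis psi_content : forall u v, ev psi u = ev psi v -> content u = content v.
Variables (I : finType) (i0 : I).
Notation M := (adj1 (pseudoword A)).
Notation V := (DO_bar H).
Notation fam := (I -> pseudoword A).
Implicit Types (w : I -> M) (L : seq fam).

Definition constH (y : fam) := forall i j, eqV H (y i) (y j).
Definition constV w := forall i j, eqM V (w i) (w j).

Definition admissible (y' y : fam) :=
  [/\ forall i, ev psi (y' i) = ev psi (y i), forall i, sigma_word sigma (y' i) &
    constH y'].

Hypothesis admissible_ex : forall y, constH y -> exists y', admissible y' y.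

Lemma admissible_seq L : List.Forall constH L -> exists L', List.Forall2 admissible L' L.
Proof.
elim: L => [|y L IH] cL; first by exists nil.
have [L' LL'] := IH (List.Forall_inv_tail cL).
have [y' yy'] := admissible_ex (List.Forall_inv cL).
by exists (y' :: L'); constructor.
Qed.

Definition mprod L (i : I) : M := foldr (fun y x => (Some (y i) : M) * x) None L.

Lemma mprod_cat L1 L2 i : mprod (L1 ++ L2) i = mprod L1 i * mprod L2 i.
Proof. by elim: L1 => //= y L1 IH; rewrite IH mulgA. Qed.

Definition msigma (x : M) :=
  if x is Some u then sigma_word (add_omega sigma) u else True.

Lemma add_omegaM : implicit_signature (add_omega sigma).
Proof. by left. Qed.

Lemma msigmaM x z : msigma x -> msigma z -> msigma (x * z).
Proof.
by case: x z => [x|] [z|] //= sx sz; apply: sigma_word_mul => //; apply: add_omegaM.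
Qed.

Lemma sigma_word_add (u : pseudoword A) : sigma_word sigma u ->
  sigma_word (add_omega sigma) u.
Proof. by elim=> [a|n w f sw _ IH]; [constructor | apply: sigma_word_op => //; left]. Qed.

(* The families [L] are variables that only need to be solved over [H]; each of
   their sigma-solutions yields a solution for [w] over [V]. *)
Definition solvable (idem : bool) w := exists L,
  [/\ List.Forall constH L, forall i, eqM H (w i) (mprod L i) &
    forall L', List.Forall2 admissible L' L -> exists w',
      [/\ constV w', forall i, mev psi (w' i) = mev psi (w i),
          forall i, msigma (w' i) & forall i, eqM H (w' i) (mprod L' i)] /\
      (idem -> (forall i, eqM H (mprod L' i * mprod L' i) (mprod L' i)) ->
        forall i, eqM V (w' i * w' i) (w' i))].

Lemma solvableW w : solvable true w -> solvable false w.
Proof.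
move=> [L [cL wL sol]]; exists L; split=> // L' /sol[w' [? _]].
by exists w'.
Qed.

Lemma solvable_mul w v :
  solvable false w -> solvable false v -> solvable false (fun i => w i * v i).
Proof.
move=> [L [cL wL sol]] [K [cK vK kol]]; exists (L ++ K)%list; split.
- by apply/List.Forall_app.
- by move=> i; rewrite mprod_cat; apply: eqMM.
move=> N /List.Forall2_app_inv_r[L' [K' [/sol[w' [[cw w'w sw wL'] _]] [/kol[v' [[cv v'v
  sv vK'] _]] ->]]]].
exists (fun i => w' i * v' i); split=> //; split.
- by move=> i j; apply: eqMM.
- by move=> i; rewrite !mevM w'w v'v.
- by move=> i; apply: msigmaM.
- by move=> i; rewrite mprod_cat; apply: eqMM.
Qed.

Lemma solvable1 : solvable false (fun=> None).
Proof.
exists nil; split=> // L' LL'; inversion LL'.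
by exists (fun=> None).
Qed.

(** The letter is listed as a variable because it counts in the product over [H]; [psi_gen] forces
    every admissible replacement to be the letter itself. *)
Lemma solvable_gen a : solvable false (fun=> gen a).
Proof.
exists [:: fun=> Omega_gen allS a]; split=> //; first by constructor.
move=> L' LL'; inversion LL' as [|y' ? N ? [yE sy _] NN]; subst.
inversion NN; subst.
exists (fun=> gen a); split=> //; split=> // [i|i]; first exact: sigma_word_gen.
by rewrite /= mulx1 (@psi_gen (y' i) a) // yE ev_gen.
Qed.

Lemma mev_psi_content (x z : M) : mev psi x = mev psi z -> mcontent x = mcontent z.
Proof. by case: x z => [x|] [z|] // [/psi_content]. Qed.

(** Used for the bases of omega powers: their variables are solved at once, since these powers
    contribute nothing to the product over [H]. *)
Lemma solvable_const (b : fam) : solvable false (fun i => Some (b i)) -> exists b' : fam,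
  [/\ forall i j, eqV V (b' i) (b' j), forall i, ev psi (b' i) = ev psi (b i)
    & forall i, sigma_word (add_omega sigma) (b' i)].
Proof.
move=> [L [/admissible_seq[L' LL'] _ /(_ _ LL')[w [[cw wb sw _] _]]]].
have wE i : w i = (Some (odflt (b i) (w i)) : M) by move: (wb i); case: (w i).
exists (fun i => odflt (b i) (w i)); split=> [i j|i|i].
- by apply/eqM_Some; rewrite -!wE; apply: cw.
- by have := wb i; rewrite {1}wE => -[].
- by rewrite -[sigma_word _ _]/(msigma (Some _)) -wE; apply: sw.
Qed.

Lemma mul_spow_r (x : adj1 S) (t : S) k :
  x * (Some t : adj1 S) = x -> x * (Some (spow t k) : adj1 S) = x.
Proof.
move=> xt; elim: k => //= k IH; rewrite -/(spow t k).
by rewrite SomeM mulgA xt.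
Qed.

Lemma mul_spow_l (x : adj1 S) (t : S) k :
  (Some t : adj1 S) * x = x -> (Some (spow t k) : adj1 S) * x = x.
Proof.
move=> xt; elim: k => //= k IH; rewrite -/(spow t k).
by rewrite SomeM -mulgA IH.
Qed.

(** The solution is p' c^omega u' c'^omega q'. Values in [S] are kept because [p] absorbs [b] and
    [q] absorbs [b']. The sandwich makes the middle constant over V as soon as [u'] is constant over
    [H], and over [H] the omega powers vanish. *)
Lemma solvable_regular (B : {set A}) (p q : I -> M) (b b' u : fam) :
  solvable false p -> solvable false q ->
  solvable false (fun i => Some (b i)) -> solvable false (fun i => Some (b' i)) ->
  constH u ->
  (forall i, content (b i) = B) -> (forall i, content (b' i) = B) ->
  (forall i, mcontent (p i) \subset B) -> (forall i, mcontent (q i) \subset B) ->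
  (forall i, content (u i) \subset B) ->
  (forall i, mev psi (p i * (Some (b i) : M)) = mev psi (p i)) ->
  (forall i, mev psi ((Some (b' i) : M) * q i) = mev psi (q i)) ->
  solvable true (fun i => p i * (Some (u i) : M) * q i).
Proof.
move=> [L [cL pL sol]] [K [cK qK kol]] /solvable_const[c [cc cb sc]].
move=> /solvable_const[c' [cc' cb' sc']] cu bB b'B pB qB uB pb bq.
have cB i : content (c i) = B by rewrite (psi_content (cb i)).
have cB' i : content (c' i) = B by rewrite (psi_content (cb' i)).
exists (L ++ u :: K)%list; split.
- by apply/List.Forall_app; split=> //; constructor.
- by move=> i; rewrite mprod_cat /= mulgA; apply: eqMM => //; apply: eqMM.
move=> N /List.Forall2_app_inv_r[L' [K1 [/sol[p' [[cp p'p sp pL'] _]] [uK ->]]]].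
inversion uK as [|u' ? K' ? [u'u su cu'] KK]; subst.
have [q' [[cq q'q sq qK'] _]] := kol _ KK.
have p'B i : mcontent (p' i) \subset B by rewrite (mev_psi_content (p'p i)).
have q'B i : mcontent (q' i) \subset B by rewrite (mev_psi_content (q'q i)).
have u'B i : content (u' i) \subset B by rewrite (psi_content (u'u i)).
pose e i := omega (c i); pose f i := omega (c' i).
pose mid i : M := Some (e i * u' i * f i).
have mid_u i : eqM H (mid i) (Some (u' i)) by apply/eqM_Some; apply: omega_sandwich_H.
have wH i : eqM H (p' i * mid i * q' i) (mprod (L' ++ u' :: K')%list i).
  by rewrite mprod_cat /= mulgA; apply: eqMM => //; apply: eqMM.
have sandwich i (s t : pseudoword A) : content s \subset B -> content t \subset B ->
    eqV H s t -> eqV V (e i * s * f i) (e i * t * f i).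
  by move=> sB tB st; apply: omega_sandwich => //; rewrite ?cB ?cB'.
exists (fun i => p' i * mid i * q' i); split; first split=> //.
- move=> i j; apply: eqMM => //; apply: eqMM => //; apply/eqM_Some.
  apply: (etrans (sandwich i (u' i) (u' j) _ _ _)) => //.
  by apply: eqVM; [apply: eqVM => // |]; apply: eqV_omega => //; apply: DO_bar_table.
- move=> i; rewrite !mevM p'p q'q; have [_ [k ek]] := ev_omega psi (c i).
  have [_ [k' fk]] := ev_omega psi (c' i).
  have -> : mev psi (mid i) = (Some (spow (ev psi (b i)) k) :
    adj1 S) * mev psi (Some (u i)) *
      (Some (spow (ev psi (b' i)) k') : adj1 S).
    by rewrite /mid /mev /= !evM ek fk cb cb' u'u.
  have pt : mev psi (p i) * (Some (ev psi (b i)) : adj1 S) = mev psi (p i).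
    by have := pb i; rewrite mevM.
  have qt : (Some (ev psi (b' i)) : adj1 S) * mev psi (q i) = mev psi (q i).
    by have := bq i; rewrite mevM.
  by rewrite !mulgA (mul_spow_r k pt) -!mulgA (mul_spow_l k' qt).
- move=> i; apply: msigmaM => //; apply: msigmaM => //=.
  apply: sigma_word_mul (sigma_word_omega _); [exact: add_omegaM | | exact: sc'].
  apply: sigma_word_mul (sigma_word_omega _) _; [exact: add_omegaM | exact: sc |].
  exact: sigma_word_add.
move=> _ idH i.
(* The square of the solution is [p' * (e * X * f) * q'], so by the sandwich it suffices that [X]
   and [u'] agree over [H]; this is [conjugate_trivial]. *)
pose X : M := (Some (u' i * f i) : M) * (q' i * p' i) * (Some (e i * u' i) : M).
have [x xE] : exists x, (Some x : M) = X.
  by rewrite /X; case: (q' i * p' i) => [r|]; eexists.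
have -> : p' i * mid i * q' i * (p' i * mid i * q' i) =
    p' i * (Some (e i * x * f i) : M) * q' i.
  by rewrite 2!SomeM xE /X /mid !SomeM !mulgA.
apply: eqMM => //; apply: eqMM => //; apply/eqM_Some; apply: sandwich => //.
  have -> : content x = mcontent X by rewrite -xE.
  rewrite /X !mcontentM /= !contentM !content_omega cB cB' !finset.subUset !subxx.
  by rewrite u'B q'B p'B.
apply: (conjugate_trivial HH xE).
have gE : eqM H (p' i * (Some (u' i) : M) * q' i) (mprod (L' ++ u' :: K')%list i).
  by rewrite mprod_cat /= mulgA; apply: eqMM => //; apply: eqMM.
apply: eqM_trans (eqMM gE gE) _; apply: eqM_trans (idH i) _.
exact: eqM_sym.
Qed.

(** * Induction on the content *)

Lemma mcontent_eq0 (x : M) : mcontent x = finset.set0 -> x = None.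
Proof.
case: x => // u /=; suff [a au] : exists a, a \in content u by move=> u0; move: au;
  rewrite u0 inE.
apply: (@ev_content_ind _ _ (fun=> ord0 :
  lzero_sg 0) (fun _ C => exists a, a \in C)) => [a|_ _ C D [a aC] _].
  by exists a; rewrite inE.
by exists a; rewrite inE aC.
Qed.

(** The letter sought is the last one to make its first appearance. Starting from any first
    occurrence, a letter still missing from the prefix is found in [y], and passing to its first
    occurrence enlarges the content of the prefix. *)
Lemma basic_factorization (z : M) : mcontent z != finset.set0 ->
  exists a (x y : M), [/\ z = x * gen a * y, a \notin mcontent x & a |: mcontent x =
    mcontent z].
Proof.
move=> /finset.set0Pn[a0 /first_occurrence[x0 [y0 [zE ax]]]].
have [n] := ubnP (#|mcontent z| - #|mcontent x0|).
elim: n a0 x0 y0 zE ax => // n IH a x y zE ax le_n.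
have cz : mcontent z = (a |: mcontent x) :|: mcontent y.
  by rewrite zE !mcontentM mcontent_gen [mcontent x :|: _]finset.setUC.
have [cxz|] := eqVneq (a |: mcontent x) (mcontent z); first by exists a, x, y.
rewrite eq_sym finset.eqEsubset negb_and => /orP[|]; last by rewrite cz finset.subsetUl.
move=> /subsetPn[b bz bax]; have by_ : b \in mcontent y.
  by move: bz; rewrite cz inE (negPf bax).
have [x' [y' [yE bx']]] := first_occurrence by_.
apply: (IH b (x * gen a * x') y').
- by rewrite zE yE !mulgA.
- rewrite !mcontentM mcontent_gen inE negb_or bx' andbT.
  by rewrite finset.setUC.
have cx : (#|mcontent x| < #|mcontent (x * gen a * x')%g|)%N.
  apply: proper_card; rewrite !mcontentM -finset.setUA; apply/properP; split.
    exact: finset.subsetUl.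
  by exists a => //; rewrite mcontent_gen !inE eqxx orbT.
have cz' : (#|mcontent (x * gen a * x')%g| <= #|mcontent z|)%N.
  by apply: subset_leq_card; rewrite zE yE !mcontentM -!finset.setUA
    finset.setUS // finset.setUS // finset.subsetUl.
by rewrite -ltnS; apply: leq_trans le_n; rewrite ltnS ltn_sub2l // (leq_trans cx).
Qed.

Lemma constV_content w : constV w -> forall i, mcontent (w i) = mcontent (w i0).
Proof. by move=> cw i; apply: (eqM_content HH). Qed.

(** The letter is found at [i0] and occurs in all members, which have equal content. Uniqueness of
    the splitting makes both factors constant over V and carries the content of the prefix from [i0]
    to every index. *)
Lemma first_letter w : constV w -> mcontent (w i0) != finset.set0 ->
  exists a (x y : I -> M), [/\ w = (fun i => x i * gen a * y i), constV x, constV y,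
    forall i, a \notin mcontent (x i) & forall i, a |: mcontent (x i) = mcontent (w i)].
Proof.
move=> cw /basic_factorization[a [x0 [y0 [w0 ax0 cx0]]]].
have aw i : a \in mcontent (w i) by rewrite (constV_content cw) -cx0 !inE eqxx.
have [x xP] := choice (fun i => first_occurrence (aw i)).
have [y yP] := choice xP.
have uniq i j : eqM V (x i) (x j) /\ eqM V (y i) (y j).
  have [wi ai] := yP i; have [wj aj] := yP j.
  by apply: (first_occurrence_uniq HH ai aj); rewrite -wi -wj.
exists a, x, y; split=> [|i j|i j|i|i]; last first.
- rewrite (constV_content cw) -cx0; congr (_ |: _); apply: (eqM_content HH).
  have [wi ai] := yP i.
  by apply: (proj1 (first_occurrence_uniq HH (y := y i) (y' := y0) ai ax0 _));
    rewrite -wi -w0.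
- exact: (yP i).2.
- exact: (uniq i j).2.
- exact: (uniq i j).1.
by apply: functional_extensionality_dep => i; have [] := yP i.
Qed.

Lemma constV_rev w : constV w -> constV (fun i => mrev (w i)).
Proof. by move=> cw i j; apply: eqM_rev. Qed.

Lemma last_letter w : constV w -> mcontent (w i0) != finset.set0 ->
  exists a (x y : I -> M), [/\ w = (fun i => y i * gen a * x i), constV x, constV y,
    forall i, a \notin mcontent (x i) & forall i, a |: mcontent (x i) = mcontent (w i)].
Proof.
move=> /constV_rev cw; rewrite -mcontent_rev.
move=> /(first_letter cw)[a [x [y [wE /constV_rev cx /constV_rev cy ax cxw]]]].
exists a, (fun i => mrev (x i)), (fun i => mrev (y i)); split=> // [|i|i].
- apply: functional_extensionality_dep => i.
  by rewrite -[LHS]mrevK (congr1 (fun f => f i) wE) !mrevM mrev_gen mulgA.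
- by rewrite mcontent_rev.
- by rewrite mcontent_rev cxw mcontent_rev.
Qed.

(** All values in S^1 at once, as a point of a finite type for the pigeonhole argument. *)
Definition psival w : {ffun I -> adj1 S} := [ffun i => mev psi (w i)].

Section Step.
Variable B : {set A}.
Hypothesis B0 : B != finset.set0.
Hypothesis solvable_smaller :
  forall w, constV w -> mcontent (w i0) \proper B -> solvable false w.

Definition rest w := constV w /\ forall i, mcontent (w i) = B.

(** The factors to be peeled off. They end with the first occurrence of the last new letter, whence
    the cancellation. *)
Definition blockl w := [/\ solvable false w, rest w &
  forall i (s t : M), eqM V (w i * s) (w i * t) -> eqM V s t].
Definition blockr w := [/\ solvable false w, rest w &
  forall i (s t : M), eqM V (s * w i) (t * w i) -> eqM V s t].

(** The state in which peeling stops. The negative clause refutes idempotency, with [v] built from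
    the family itself. *)
Definition donel w := solvable false w /\
  ~ exists v, (forall i, mcontent (v i) = B) /\ forall i, eqM V (w i * v i) (w i).
Definition doner w := solvable false w /\
  ~ exists v, (forall i, mcontent (v i) = B) /\ forall i, eqM V (v i * w i) (w i).

Definition fmul w v i := w i * v i.

Lemma fmulA : associative fmul.
Proof. by move=> w v x; apply: functional_extensionality_dep => i; apply: mulgA. Qed.

Lemma rest_mul w v : rest w -> rest v -> rest (fmul w v).
Proof.
move=> [cw wB] [cv vB]; split=> [i j|i]; first exact: eqMM.
by rewrite mcontentM wB vB finset.setUid.
Qed.

Lemma blockl_mul w v : blockl w -> blockl v -> blockl (fmul w v).
Proof.
move=> [sw rw kw] [sv rv kv]; split; [exact: solvable_mul | exact: rest_mul |].
by move=> i s t; rewrite /fmul -!mulgA => /kw /kv.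
Qed.

Lemma blockr_mul w v : blockr w -> blockr v -> blockr (fmul v w).
Proof.
move=> [sw rw kw] [sv rv kv]; split; [exact: solvable_mul | exact: rest_mul |].
by move=> i s t; rewrite /fmul !mulgA => /kw /kv.
Qed.

Lemma donel_mul w v : blockl w -> donel v -> donel (fmul w v).
Proof.
move=> [sw rw kw] [sv nv]; split; first exact: solvable_mul.
move=> [x [xB xv]]; apply: nv; exists x; split=> // i.
by apply: (kw i); rewrite mulgA; apply: xv.
Qed.

Lemma doner_mul w v : blockr w -> doner v -> doner (fmul v w).
Proof.
move=> [sw rw kw] [sv nv]; split; first exact: solvable_mul.
move=> [x [xB xv]]; apply: nv; exists x; split=> // i.
by apply: (kw i); rewrite -mulgA; apply: xv.
Qed.

(** The prefix before the last new letter misses that letter, so induction solves it. If the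
    remainder has smaller content, it is solved too, and comparing contents shows that it cannot
    absorb a factor of content [B]. *)
Lemma stepl w : rest w ->
  (exists z y : I -> M, [/\ w = fmul z y, blockl z & rest y]) \/ donel w.
Proof.
move=> [cw wB]; have := wB i0 => wB0.
have [|a [x [y [wE cx cy ax cxw]]]] := first_letter cw; first by rewrite wB0.
have {}wE : w = fmul (fun i => x i * gen a) y by [].
have xB i : a |: mcontent (x i) = B by rewrite cxw wB.
have yB i : mcontent (y i) \subset B.
  by rewrite -(wB i) wE mcontentM finset.subsetUr.
have sx : solvable false x.
  apply: solvable_smaller => //; rewrite -(xB i0) finset.setUC.
  by apply/properP; split; [apply: finset.subsetUl | exists a; rewrite // !inE eqxx orbT].
have kz i s t : eqM V (x i * gen a * s) (x i * gen a * t) -> eqM V s t.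
  by move=> /(first_occurrence_uniq HH (ax i) (ax i))[].
have bz : blockl (fun i => x i * gen a).
  split=> //; first exact: solvable_mul sx (solvable_gen a).
  split=> [i j|i]; first exact: eqMM.
  by rewrite mcontentM mcontent_gen finset.setUC.
have [yB0|yB0] := eqVneq (mcontent (y i0)) B.
  left; exists (fun i => x i * gen a), y; split=> //; split=> // i.
  by rewrite constV_content.
right; rewrite wE; apply: donel_mul => //; split.
  by apply: solvable_smaller => //; rewrite finset.properEneq yB0 yB.
move=> [v [vB yv]]; case/negP: yB0; rewrite finset.eqEsubset yB /=.
by rewrite -(eqM_content HH (yv i0)) mcontentM vB finset.subsetUr.
Qed.

Lemma stepr w : rest w ->
  (exists z y : I -> M, [/\ w = fmul y z, blockr z & rest y]) \/ doner w.
Proof.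
move=> [cw wB]; have := wB i0 => wB0.
have [|a [x [y [wE cx cy ax cxw]]]] := last_letter cw; first by rewrite wB0.
have {}wE : w = fmul y (fun i => gen a * x i).
  by rewrite wE; apply: functional_extensionality_dep => i; rewrite /fmul mulgA.
have xB i : a |: mcontent (x i) = B by rewrite cxw wB.
have yB i : mcontent (y i) \subset B.
  by rewrite -(wB i) wE mcontentM finset.subsetUl.
have sx : solvable false x.
  apply: solvable_smaller => //; rewrite -(xB i0) finset.setUC.
  by apply/properP; split; [apply: finset.subsetUl | exists a; rewrite // !inE eqxx orbT].
have bz : blockr (fun i => gen a * x i).
  split.
  - exact: solvable_mul (solvable_gen a) sx.
  - by split=> [i j|i]; [apply: eqMM | rewrite mcontentM mcontent_gen].
  by move=> i s t; rewrite !mulgA => /(last_occurrence_uniq HH (ax i) (ax i))[].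
have [yB0|yB0] := eqVneq (mcontent (y i0)) B.
  left; exists (fun i => gen a * x i), y; split=> //; split=> // i.
  by rewrite constV_content.
right; rewrite wE; apply: doner_mul => //; split.
  by apply: solvable_smaller => //; rewrite finset.properEneq yB0 yB.
move=> [v [vB yv]]; case/negP: yB0; rewrite finset.eqEsubset yB /=.
by rewrite -(eqM_content HH (yv i0)) mcontentM vB finset.subsetUl.
Qed.

Lemma rest_Some w : rest w -> exists y : fam, w = (fun i => Some (y i)).
Proof.
move=> [_ wB]; have wS i : exists y : pseudoword A, w i = Some y.
  case wi : (w i) => [y|]; first by exists y.
  by case/negP: B0; rewrite -(wB i) wi.
by have [y yP] := choice wS; exists y; apply: functional_extensionality_dep.
Qed.

(** Blocks are peeled off from the left, then from the right of the remainder. If either process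
    stops, [w] is a product of solvable families and is not idempotent; if neither does, the two
    repetitions meet the hypotheses of [solvable_regular]. *)
Lemma solvable_rest w : rest w -> solvable false w /\
  ((forall i, eqM V (w i * w i) (w i)) -> solvable true w).
Proof.
move=> rw.
have [[sw nw]|[p [b [y [wE bp bb ry pb]]]]] :=
    iterate_factorization psival fmulA blockl_mul donel_mul stepl rw.
  split=> // ww; case: nw; exists w; split=> // i; exact: rw.2.
have fmulA' : associative (fun w v => fmul v w) by move=> ? ? ?; rewrite fmulA.
have [[sy ny]|[q [b' [u [yE bq bb' ru qb]]]]] :=
    iterate_factorization psival fmulA' blockr_mul doner_mul stepr ry.
  have [sp rp kp] := bp; rewrite wE; split=> [|ww]; first exact: solvable_mul.
  (* Cancelling [p] in p y p y = p y gives (y p) y = y. *)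
  case: ny; exists (fmul y p); split=> i; first exact: (rest_mul ry rp).2.
  by apply: (kp i); have := ww i; rewrite /fmul !mulgA.
suff st : solvable true w by split=> //; apply: solvableW.
have [sp rp _] := bp; have [sq rq _] := bq; have [sb rb _] := bb; have [sb' rb' _] := bb'.
have [c cE] := rest_Some rb; have [c' cE'] := rest_Some rb'; have [v vE] := rest_Some ru.
subst b b' u.
have -> : w = (fun i => p i * (Some (v i) : M) * q i).
  by rewrite wE yE; apply: functional_extensionality_dep => i; rewrite /fmul mulgA.
apply: (@solvable_regular B p q c c' v) => // [i j|i|i|i|i|i|i|i].
- by apply/eqM_Some/(eqM_H HH)/ru.1.
- exact: rb.2 i.
- exact: rb'.2 i.
- by rewrite rp.2.
- by rewrite rq.2.
- by rewrite -[content _]/(mcontent (Some (v i))) ru.2.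
- by have := congr1 (fun f : {ffun I -> adj1 S} => f i) pb; rewrite !ffunE.
- by have := congr1 (fun f : {ffun I -> adj1 S} => f i) qb; rewrite !ffunE.
Qed.
End Step.

Lemma solvable_constV w : constV w -> solvable false w /\
  (w i0 <> None -> eqM V (w i0 * w i0) (w i0) -> solvable true w).
Proof.
have [n] := ubnP #|mcontent (w i0)|; elim: n w => // n IH w le_n cw.
have [w0|w0] := eqVneq (mcontent (w i0)) finset.set0.
  have wN i : w i = None by apply: mcontent_eq0; rewrite constV_content.
  split=> [|//]; rewrite (_ : w = fun=> None); first exact: solvable1.
  exact: functional_extensionality_dep.
have sm v : constV v -> mcontent (v i0) \proper mcontent (w i0) -> solvable false v.
  by move=> cv vw; apply: (proj1 (IH v _ cv)); apply: leq_trans (proper_card vw) _.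
have rw : rest (mcontent (w i0)) w by split=> //; apply: constV_content.
have [s s'] := solvable_rest w0 sm rw; split=> // _ ww; apply: s' => i.
apply: eqM_trans (eqMM (cw i i0) (cw i i0)) _; apply: eqM_trans ww _; exact: cw.
Qed.
End Solvable.

(** * Continuous homomorphisms *)

Section Continuity.
Variable A : finType.
Implicit Types u v : pseudoword A.

Lemma nbhs_coord u (i : marked allS A) : nbhs u [set v | coord v i = coord u i].
Proof.
have cts : continuous (fun v : pseudoword A => (coord v i : discrete_topology (base i))).
  have sv := @initial_continuous (set_type [set x : marked_prod allS A | natural_family x])
    (marked_prod allS A) set_val.
  move=> v; apply: (@continuous_comp (pseudoword A) (marked_prod allS A) _ set_val
    (fun x => x i)) (sv v) _; exact: proj_continuous.
have := cts u [set coord u i].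
by apply; apply: open_nbhs_nbhs; split=> //; apply: discrete_open.
Qed.

Lemma coord_join (i j : marked allS A) : exists k, forall u v,
  coord v k = coord u k -> coord v i = coord u i /\ coord v j = coord u j.
Proof.
exists (tmark (fun a => (mark i a, mark j a))) => u v uv.
have : ev (fun a => (mark i a, mark j a)) v = ev (fun a => (mark i a, mark j a)) u.
  by rewrite /ev uv.
by rewrite !ev_pair -!coord_ev => -[].
Qed.

(** Coordinates are directed by [coord_join], so the sets containing all [v] that agree with [u] at
    one coordinate form a filter; it converges to [u] in the product. *)
Lemma nbhs_Omega u (U : set (pseudoword A)) :
  nbhs u U -> exists k : marked allS A, forall v, coord v k = coord u k -> U v.
Proof.
pose G : set_system (marked_prod allS A) := fun W =>
  exists k, forall v : pseudoword A, coord v k = coord u k -> W (set_val v).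
have GF : Filter G.
  split.
  - by exists (tmark (fun=> ord0 : lzero_sg 0)).
  - move=> W W' [i iW] [j jW']; have [k kP] := coord_join i j.
    by exists k => v /kP[/iW ? /jW' ?].
  - by move=> W W' WW' [k kW]; exists k => v /kW; apply: WW'.
have Gu : G --> (set_val u : marked_prod allS A).
  apply/cvg_sup => i W [_ [[C oC <-] Cu CW]]; exists i => v vu; apply: CW.
  by move: Cu; rewrite /preimage /= -/(coord u i) -/(coord v i) vu.
move=> [_ [[B oB <-] Bu BU]].
have [k kB] : G B by apply: Gu; apply: open_nbhs_nbhs.
by exists k => v /kB Bv; apply: BU.
Qed.

Variables (S : finSemigroupType) (phi : {multiplicative pseudoword A -> S}).

(** Near [u], [phi] depends on a single coordinate [k]. Density, applied in the product of [base k]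
    and [S], gives [v] with the same coordinate as [u] on which [phi] is the evaluation. *)
Lemma continuous_ev : continuous (phi : pseudoword A -> discrete_topology S) ->
  forall u, phi u = ev (fun a => phi (Omega_gen allS a)) u.
Proof.
move=> cphi u.
have [k kU] : exists k : marked allS A, forall v, coord v k = coord u k -> phi v = phi u.
  apply: (@nbhs_Omega u [set v | phi v = phi u]); apply: (cphi u [set phi u]).
  by apply: open_nbhs_nbhs; split=> //; apply: discrete_open.
have [v [/kU <- ->]] : exists v,
    coord v k = coord u k /\ phi v = ev (fun a => phi (Omega_gen allS a)) u; last by [].
have := @ev_ind _ _ (fun a => (mark k a, phi (Omega_gen allS a)))
  (fun p => exists v, coord v k = p.1 /\ phi v = p.2) u.
rewrite ev_pair -coord_ev; apply=> [a|[t s] [t' s'] /= [v [<- <-]] [v' [<- <-]]].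
  by exists (Omega_gen allS a).
by exists (v * v'); rewrite gmulfM.
Qed.

Lemma ev_continuous (psi : A -> S) :
  continuous (ev psi : pseudoword A -> discrete_topology S).
Proof.
move=> u U /nbhs_singleton Uu; apply: filterS (nbhs_coord u (tmark psi)) => v vu.
by rewrite /preimage /= /ev vu.
Qed.
End Continuity.

Section GeneratedSubsemigroup.
Variables (A : finType) (T : finSemigroupType) (m : A -> T) (u0 : pseudoword A).

(** Graph reducibility needs an onto homomorphism, so the codomain is cut down to the image. *)
Lemma generated_subsemigroup : exists (S : finSemigroupType) (psi : A -> S),
  (forall s, exists u, ev psi u = s) /\
  (forall u v, ev psi u = ev psi v -> ev m u = ev m v).
Proof.
pose Q t := exists u, ev m u = t.
have QM x y : Q x -> Q y -> Q (x * y).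
  by move=> [u <-] [v <-]; exists (u * v); rewrite evM.
have Qex : exists t, Q t by exists (ev m u0), u0.
have Qm a : `[< Q (m a) >] by apply/asboolP; exists (Omega_gen allS a); rewrite ev_gen.
pose psi a : sub_semigroup QM Qex := exist _ (m a) (Qm a).
have psiE u : sval (ev psi u) = ev m u :=
  @ev_nat _ _ _ psi m (sub_incl QM Qex) u (fun=> erefl).
exists (sub_semigroup QM Qex), psi; split=> [s|u v uv]; last by rewrite -!psiE uv.
have [u us] : Q (sval s) by case: s => t Qt; apply: asboolW.
by exists u; apply: (@val_inj _ _ {t : T | `[< Q t >]}); rewrite /= psiE.
Qed.
End GeneratedSubsemigroup.

Section HCancel.
Variables (H : finSemigroupType -> Prop) (HH : group_pseudovariety H) (A : finType).
Implicit Types u v w : pseudoword A.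

Lemma eqV_H_cancel u v w : eqV H (u * v) (u * w) -> eqV H v w.
Proof.
move=> uvw; apply/eqV_ev => [|T m HT]; first exact: H_table.
have [e [e1 einv]] := gpv_group HH HT.
have := (eqV_ev _ _ (H_table HH)).1 uvw T m HT; rewrite !evM => E.
have [x [_ xu]] := einv (ev m u).
by rewrite -(e1 (ev m v)).1 -(e1 (ev m w)).1 -xu -!mulgA E.
Qed.
End HCancel.

(** * Graph systems *)

Section Graph.
Variables (sigma : opset) (H : finSemigroupType -> Prop) (A : finType).
Hypotheses (HH : group_pseudovariety H) (Hred : graph_reducible sigma H).
Variables (S : finSemigroupType) (psi : A -> S).
Hypothesis psi_onto : forall s, exists u, ev psi u = s.
Variables (I : finType) (i0 : I).
Notation fam := (I -> pseudoword A).

Lemma graph_solve (Gamma : finDigraph) (gamma : digraph_var Gamma -> pseudoword A) :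
  (forall y : edge Gamma,
    eqV H (gamma (inl (source y)) * gamma (inr y)) (gamma (inl (target y)))) ->
  exists gamma', [/\ forall x, ev psi (gamma' x) = ev psi (gamma x),
    forall x, sigma_word sigma (gamma' x) &
    forall y : edge Gamma,
      eqV H (gamma' (inl (source y)) * gamma' (inr y)) (gamma' (inl (target y)))].
Proof.
move=> sol; have oc : onto_continuous (mkMul (evM psi)).
  split; first exact: ev_continuous.
  by apply/seteqP; split=> // s _; have [u us] := psi_onto s; exists u.
have [|gamma' [[g1 g2] g3]] :=
  @Hred Gamma S (fun x => ev psi (gamma x)) A (mkMul (evM psi)) oc; last by exists gamma'.
by exists gamma.
Qed.

(** Parallel edges [y i] between two vertices; cancelling the common source over [H] shows that
    their solutions agree. *)
Lemma graph_admissible_ex (y : fam) : constH H y -> exists y', admissible sigma H psi y' y.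
Proof.
move=> cy; pose Gamma := @FinDigraph bool I (fun=> false) (fun=> true).
pose gamma (x : digraph_var Gamma) := match x with
  | inl b => if b then y i0 * y i0 else y i0 | inr i => y i end.
have [|g [g1 g2 g3]] := @graph_solve Gamma gamma.
  by move=> i /=; apply: eqVM => //; apply: cy.
exists (fun i => g (inr i)); split=> [i|i|i j]; [exact: g1 | exact: g2 |].
apply: (eqV_H_cancel HH (u := g (inl false))).
exact: (etrans (g3 i) (esym (g3 j))).
Qed.

Lemma mprod_mkseqS (y : nat -> fam) n i :
  mprod (mkseq y n.+1) i = mprod (mkseq y n) i * (Some (y n i) : adj1 (pseudoword A)).
Proof.
rewrite mkseqS -cats1; elim: (mkseq y n) => //= z L ->.
by rewrite mulgA.
Qed.

Lemma Forall2_mkseq (X Y : Type) (R : X -> Y -> Prop) (f : nat -> X) (g : nat -> Y) n :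
  (forall k, (k < n)%N -> R (f k) (g k)) -> List.Forall2 R (mkseq f n) (mkseq g n).
Proof.
elim: n => [|n IH] fg; first by constructor.
rewrite !mkseqS -!cats1; apply: List.Forall2_app; last by constructor; [apply: fg |].
by apply: IH => k kn; apply: fg; apply: ltnW.
Qed.

Lemma mprod_mkseq_Some (y : nat -> fam) n i : exists u, mprod (mkseq y n.+1) i = Some u.
Proof. by rewrite mprod_mkseqS; case: (mprod _ _) => [u|]; eexists. Qed.

(* The equation "x_0 ... x_n = 1" over [H] is the system of a cycle of length
   [n.+1]; parallel edges make the values of a variable equal over [H]. *)
Lemma cycle_admissible (y : nat -> fam) n : (forall k, (k <= n)%N -> constH H (y k)) ->
  eqM H (mprod (mkseq y n.+1) i0 * mprod (mkseq y n.+1) i0) (mprod (mkseq y n.+1) i0) ->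
  exists y', (forall k, (k <= n)%N -> admissible sigma H psi (y' k) (y k)) /\
    forall i, eqM H (mprod (mkseq y' n.+1) i * mprod (mkseq y' n.+1) i)
      (mprod (mkseq y' n.+1) i).
Proof.
move=> cy yy.
have [p pE] := choice (fun k => mprod_mkseq_Some y k i0).
have pS k : p k.+1 = p k * y k.+1 i0.
  by apply: Some_inj; rewrite -pE mprod_mkseqS pE.
have p0 : p 0%N = y 0%N i0 by apply: Some_inj; rewrite -pE.
have pp : eqV H (p n * p n) (p n) by apply/eqM_Some; rewrite SomeM -pE.
(* Vertex [k] carries the prefix product [p k], and the edges into it carry [y k]; the predecessor
   of 0 is [n]. *)
pose prev (k : 'I_n.+1) : 'I_n.+1 := if k == ord0 then ord_max else inord k.-1.
pose Gamma := @FinDigraph 'I_n.+1 ('I_n.+1 * I)%type (fun e => prev e.1) (fun e => e.1).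
pose gamma (x : digraph_var Gamma) := match x with
  | inl k => p k | inr (k, i) => y k i end.
have [|g [g1 g2 g3]] := @graph_solve Gamma gamma.
  move=> [k i] /=; have kn : (k <= n)%N by rewrite -ltnS.
  apply: (etrans (eqVM (erefl _) (cy k kn i i0))); rewrite /prev.
  (* The edges into 0 close the cycle: [p n] is idempotent, hence trivial over [H]. *)
  case: eqP => [->|/eqP k0] /=.
    rewrite p0; apply: (eqV_H_cancel HH (u := p n)).
    by rewrite mulgA; apply: eqVM.
  have kE : nat_of_ord k = (k.-1).+1.
    by rewrite prednK // lt0n; apply: contraNneq k0 => k0; apply/eqP/val_inj.
  have -> : nat_of_ord (inord k.-1 : 'I_n.+1) = k.-1.
    by rewrite inordK // ltnS (leq_trans (leq_pred k)).
  by rewrite -[p k in RHS]/(p k) [in RHS]kE pS -kE.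
pose y' k : fam := fun i => g (inr (inord k, i)).
have edge k i : (k <= n)%N ->
    eqV H (g (inl (prev (inord k))) * y' k i) (g (inl (inord k))) by move=> kn;
      exact: (g3 (inord k, i)).
exists y'; split=> [k kn|i].
  split=> [i|i|i j]; [by rewrite g1 /= inordK | exact: g2 |].
  apply: (eqV_H_cancel HH (u := g (inl (prev (inord k))))).
  exact: (etrans (edge k i kn) (esym (edge k j kn))).
have [q qE] := choice (fun k => mprod_mkseq_Some y' k i).
(* Walking once around the cycle from vertex [n] shows that [g (inl ord_max)] absorbs the full
   product [q n], which is therefore trivial over [H]. *)
have acc k : (k <= n)%N -> eqV H (g (inl ord_max) * q k) (g (inl (inord k))).
  elim: k => [|k IH] kn.
    have -> : q 0%N = y' 0%N i by apply: Some_inj; rewrite -qE.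
    have := edge 0%N i kn; rewrite /prev.
    by have -> : inord 0 == ord0 :> 'I_n.+1 by apply/eqP/val_inj; rewrite /= inordK.
  have -> : q k.+1 = q k * y' k.+1 i by apply: Some_inj; rewrite -qE mprod_mkseqS qE.
  have := edge k.+1 i kn; rewrite /prev -(inj_eq val_inj) /= inordK //= => E.
  rewrite mulgA; apply: etrans E; apply: eqVM => //.
  exact: IH (ltnW kn).
rewrite qE -SomeM; apply/eqM_Some; apply: (eqV_H_cancel HH (u := g (inl ord_max))).
have qn : eqV H (g (inl ord_max) * q n) (g (inl ord_max)).
  have := acc n (leqnn n); have -> // : inord n = ord_max :> 'I_n.+1.
  by apply: val_inj; rewrite /= inordK.
by rewrite mulgA; apply: eqVM.
Qed.
End Graph.

(** * From a pointlike set to a solvable family and back *)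

Theorem corollary4p4 (sigma : opset) (H : finSemigroupType -> Prop) :
  implicit_signature sigma ->
  group_pseudovariety H ->
  graph_reducible sigma H ->
  idem_pointlike_reducible (add_omega sigma) (DO_bar H).
Proof.
move=> sigmaM HH Hred I P [[s0 Ps0] pl] A phi phi_oc.
have [P' [phiP' [e [ee P'e]]]] := pl A phi phi_oc.
(* The family is indexed by the whole finite semigroup; an index outside [P] receives a preimage of
   [s0]. *)
have w_ex (s : I) : exists u, P' u /\ (P s -> phi u = s).
  have [|nPs] := pselect (P s).
    by rewrite -phiP' => -[u P'u us]; exists u.
  have : (phi @` P') s0 by rewrite phiP'.
  by move=> [u P'u _]; exists u.
have [w wP] := choice w_ex.
have phi_w s : P (phi (w s)) by rewrite -phiP'; exists (w s) => //; apply: (wP s).1.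
have we s : Omega_proj (DO_bar H) (w s) = e.
  have : (Omega_proj (DO_bar H) @` P') (Omega_proj (DO_bar H) (w s)).
    by exists (w s) => //; apply: (wP s).1.
  by rewrite P'e.
have phiE := continuous_ev phi_oc.1.
(* Besides [phi], the enlarged semigroup records the content and, through the null semigroup,
   whether a pseudoword is a given letter. *)
pose m a := ((phi (Omega_gen allS a), [set a]%SET : cset A), Some a : null_sg A).
have [S [psi [psi_onto psi_m]]] := generated_subsemigroup m (w s0).
have psi_phi u v : ev psi u = ev psi v -> phi u = phi v.
  by move=> /psi_m; rewrite /m !ev_pair !phiE => -[].
have psi_content u v : ev psi u = ev psi v -> content u = content v.
  by move=> /psi_m; rewrite /m !ev_pair => -[].
have psi_gen u a : ev psi u = psi a -> u = Omega_gen allS a.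
  rewrite -(ev_gen psi) => /psi_m; rewrite /m !ev_pair => -[_ _].
  rewrite ev_gen => ua; apply: pseudoword_eqP => T n; rewrite ev_gen.
  (* A product has second component [None], so the value [Some a] can only arise from the letter
     itself. *)
  have := @ev_ind _ _ (fun b => (n b, Some b : null_sg A))
    (fun p => p.2 = Some a -> p.1 = n a) u.
  by rewrite ev_pair; apply=> // b [->].
pose W s : adj1 (pseudoword A) := Some (w s).
have cW : constV H W by move=> s t; apply/eqM_Some; rewrite /eqV !we.
have adm := graph_admissible_ex HH Hred psi_onto s0.
have WW : eqM (DO_bar H) (W s0 * W s0) (W s0).
  by apply/eqM_Some; rewrite /eqV Omega_projM !we.
have [_ /(_ _ WW)[//|L [cL WL solL]]] :=
  solvable_constV sigmaM HH psi_gen psi_content s0 adm cW.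
have idL : eqM H (mprod L s0 * mprod L s0) (mprod L s0).
  have LW := eqM_sym (WL s0).
  exact: eqM_trans (eqMM LW LW) (eqM_trans (eqM_H HH WW) (WL s0)).
(* The list is nonempty since [W s0] is not the adjoined identity; the cycle therefore has at least
   one vertex. *)
have [y1 [n sL]] : exists (y1 : I -> pseudoword A) n, size L = n.+1.
  by have := WL s0; case: (L) => [|y1 K] // _; exists y1, (size K).
pose y k := nth y1 L k; have LE : L = mkseq y n.+1 by rewrite -sL mkseq_nth.
have cy k : (k <= n)%N -> constH H (y k).
  rewrite -ltnS -sL /y; elim: L k cL {WL solL idL sL y LE} => // z L IH [|k] cL kL.
    exact: List.Forall_inv cL.
  exact: IH (List.Forall_inv_tail cL) kL.
rewrite LE in idL solL.
have [y' [adm' id']] := cycle_admissible HH Hred psi_onto cy idL.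
have [w' [[cw' w'w sw' _] /(_ isT id') idw']] := solL _ (Forall2_mkseq (n := n.+1) adm').
have v_ex s : exists v, w' s = Some v.
  by have := w'w s; case: (w' s) => // u _; exists u.
have [v vE] := choice v_ex.
have cv s t : Omega_proj (DO_bar H) (v s) = Omega_proj (DO_bar H) (v t).
  by apply/eqM_Some; rewrite -!vE; apply: cw'.
have phi_v s : phi (v s) = phi (w s).
  by apply: psi_phi; have := w'w s; rewrite vE => -[].
exists (range v); split; last by move=> _ [s _ <-]; have := sw' s; rewrite vE.
split.
  apply/seteqP; split=> [_ [_ [s _ <-] <-]|s Ps]; first by rewrite phi_v; apply: phi_w.
  by exists (v s); [exists s | rewrite phi_v; apply: (wP s).2].
exists (Omega_proj (DO_bar H) (v s0)); split.
  by rewrite -Omega_projM; apply/eqM_Some; rewrite SomeM -vE; apply: idw'.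
apply/seteqP; split=> [_ [_ [s _ <-] <-]|_ ->]; first exact: cv.
by exists (v s0) => //; exists s0.
Qed.
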